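(* Let $\omega\in[0,1]$ and let $A\in\mathbb{C}^{m\times m}$, $B\in\mathbb{C}^{m\times n}$, $C\in\mathbb{C}^{n\times m}$, $D\in\mathbb{C}^{n\times n}$ be such that $XCX-XD-AX+B=0$ is in class $\mathbb{H}^\omega$, and suppose that $Q_\omega\mathbf{1}>0$, where $Q=\begin{pmatrix}D&-C\\-B&A\end{pmatrix}$. Let $\Phi$ and $\Psi$ be the extremal solutions of $XCX-XD-AX+B=0$ and of its dual $YBY-YA-DY+C=0$, respectively. Let $\chi$ be any complex number with $|\chi|=1$ such that $\omega\,\mathrm{Re}(\chi[Q]_{ii})+(1-\omega)\,\mathrm{Im}(\chi[Q]_{ii})-q_i>0$ for all $i\in\{1,\dots,m+n\}$. Apply ADDA to the transformed equation $X(\chi C)X-X(\chi D)-(\chi A)X+\chi B=0$ with $\alpha=tz_\omega^\bot$ and $\beta=\gamma z_\omega^\bot$, where $z_\omega^\bot=\omega+\mathrm{j}(1-\omega)$. If $$t\ge\widetilde\psi_1:=\max_{i=n+1,\dots,m+n}\frac{p^\chi_{\omega,i}}{\varpi},\qquad\gamma\ge\widetilde\psi_2:=\max_{i=1,\dots,n}\frac{p^\chi_{\omega,i}}{\varpi},$$ then the sequences $\{E_k\},\{F_k\},\{G_k\},\{H_k\}$ are well-defined and $\{H_k\}$ and $\{G_k\}$ converge quadratically to $\Phi$ and $\Psi$, respectively.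
   Context: For a complex square matrix $M$ and a real $\omega\in[0,1]$, the $\omega$-comparison matrix $M_\omega$ is the real matrix with entries $[M_\omega]_{ii}=\omega\,\mathrm{Re}([M]_{ii})+(1-\omega)\,\mathrm{Im}([M]_{ii})$ and $[M_\omega]_{ij}=-|[M]_{ij}|$ for $i\ne j$. A real square matrix $M$ is a nonsingular M-matrix if all its off-diagonal entries are nonpositive and $Mu>0$ (entrywise) for some vector $u>0$. $\mathbf{1}$ is the all-ones column vector; $\mathrm{j}$ is the imaginary unit. The equation $XCX-XD-AX+B=0$ is in class $\mathbb{H}^\omega$ if $Q_\omega$ is a nonsingular M-matrix. Notation: $\varpi=\omega^2+(1-\omega)^2$, $q_i=\sum_{j\ne i}|[Q]_{ij}|$, and for $i=1,\dots,m+n$ $$\frac{p^\chi_{\omega,i}}{\varpi}=\frac{\varpi|[Q]_{ii}|^2-q_i^2}{2\varpi\left(\omega\mathrm{Re}(\chi[Q]_{ii})+(1-\omega)\mathrm{Im}(\chi[Q]_{ii})-q_i\right)}.$$ Extremal solutions: $\Phi$ is the unique solution of $XCX-XD-AX+B=0$ such that every eigenvalue $\lambda$ of $D-C\Phi$ satisfies $\omega\,\mathrm{Re}(\lambda)+(1-\omega)\,\mathrm{Im}(\lambda)>0$; $\Psi$ is the unique solution of $YBY-YA-DY+C=0$ such that every eigenvalue $\lambda$ of $A-B\Psi$ satisfies the same inequality (both exist and are unique under these hypotheses). ADDA with parameters $\alpha,\beta$ applied to an equation $X\mathsf CX-X\mathsf D-\mathsf AX+\mathsf B=0$: put $\mathsf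 A_\beta=\mathsf A+\beta I$, $\mathsf D_\alpha=\mathsf D+\alpha I$, $W=\mathsf A_\beta-\mathsf B\mathsf D_\alpha^{-1}\mathsf C$, $V=\mathsf D_\alpha-\mathsf C\mathsf A_\beta^{-1}\mathsf B$, and $$E_0=I-(\alpha+\beta)V^{-1},\ F_0=I-(\alpha+\beta)W^{-1},\ G_0=(\alpha+\beta)\mathsf D_\alpha^{-1}\mathsf CW^{-1},\ H_0=(\alpha+\beta)W^{-1}\mathsf B\mathsf D_\alpha^{-1};$$ for $k\ge0$, $$E_{k+1}=E_k(I-G_kH_k)^{-1}E_k,\quad F_{k+1}=F_k(I-H_kG_k)^{-1}F_k,$$ $$G_{k+1}=G_k+E_k(I-G_kH_k)^{-1}G_kF_k,\quad H_{k+1}=H_k+F_k(I-H_kG_k)^{-1}H_kE_k.$$ ''Well-defined'' means all inverses involved exist. Quadratic convergence of the doubling algorithm means $\limsup_{k\to\infty}\|H_k-\Phi\|^{1/2^k}<1$ and $\limsup_{k\to\infty}\|G_k-\Psi\|^{1/2^k}<1$. *)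

(* Defs.v *)
From HB Require Import structures.
From mathcomp Require Import all_boot all_order all_algebra.
From mathcomp Require Import all_classical all_reals all_analysis.
From mathcomp Require Import complex.

Set Implicit Arguments.
Unset Strict Implicit.
Unset Printing Implicit Defensive.

Import Order.TTheory GRing.Theory Num.Theory.

Local Open Scope ring_scope.
Local Open Scope complex_scope.

Section ScalarsAndMatrices.
Variable R : realType.
Implicit Types (omega : R) (z : R[i]).

(* [`|z|] has type [R[i]]; its imaginary part is 0. *)
Definition cmod z : R := complex.Re `|z|.

Definition omega_re omega z : R :=
  omega * complex.Re z + (1 - omega) * complex.Im z.

Definition z_perp omega : R[i] := omega +i* (1 - omega).

Definition varpi omega : R := omega ^+ 2 + (1 - omega) ^+ 2.

Definition comparison_mx omega k (M : 'M[R[i]]_k) : 'M[R]_k :=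
  \matrix_(i, j) (if i == j then omega_re omega (M i i) else - cmod (M i j)).

Definition pos_cvec k (u : 'cV[R]_k) : Prop := forall i, 0 < u i 0.

Definition ones k : 'cV[R]_k := const_mx 1.

Definition nonsingular_M_matrix k (M : 'M[R]_k) : Prop :=
  (forall i j, i != j -> M i j <= 0) /\
  (exists u : 'cV[R]_k, pos_cvec u /\ pos_cvec (M *m u)).

Definition offdiag_sum k (M : 'M[R[i]]_k) (i : 'I_k) : R :=
  \sum_(j | j != i) cmod (M i j).

(* The quantity p^chi_{omega,i} / varpi. *)
Definition p_over_varpi omega (chi : R[i]) k (M : 'M[R[i]]_k) (i : 'I_k) : R :=
  (varpi omega * cmod (M i i) ^+ 2 - offdiag_sum M i ^+ 2) /
  (2 * varpi omega * (omega_re omega (chi * M i i) - offdiag_sum M i)).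

Definition is_norm m n (N : 'M[R[i]]_(m, n) -> R) : Prop :=
  [/\ forall X Y, N (X + Y) <= N X + N Y,
      forall (a : R[i]) X, N (a *: X) = cmod a * N X &
      forall X, N X = 0 -> X = 0].

(* All norms on a finite-dimensional space give the same condition here;
   none is singled out. *)
Definition quadratic_cvg m n (X : nat -> 'M[R[i]]_(m, n))
    (L : 'M[R[i]]_(m, n)) : Prop :=
  forall N : 'M[R[i]]_(m, n) -> R, is_norm N ->
    (limn_esup (fun k => ((N (X k - L)) `^ ((2 ^+ k)^-1))%:E) < 1)%E.

End ScalarsAndMatrices.

Section Riccati.
Variable R : realType.
Implicit Types omega : R.

Definition are_solution m n (A : 'M[R[i]]_m) (B : 'M[R[i]]_(m, n))
    (C : 'M[R[i]]_(n, m)) (D : 'M[R[i]]_n) (X : 'M[R[i]]_(m, n)) : Prop :=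
  X *m C *m X - X *m D - A *m X + B = 0.

Definition are_mx m n (A : 'M[R[i]]_m) (B : 'M[R[i]]_(m, n))
    (C : 'M[R[i]]_(n, m)) (D : 'M[R[i]]_n) : 'M[R[i]]_(n + m) :=
  block_mx D (- C) (- B) A.

Definition class_H omega m n (A : 'M[R[i]]_m) (B : 'M[R[i]]_(m, n))
    (C : 'M[R[i]]_(n, m)) (D : 'M[R[i]]_n) : Prop :=
  nonsingular_M_matrix (comparison_mx omega (are_mx A B C D)).

(* The dual equation YBY - YA - DY + C = 0 is the equation with
   coefficients (D, C, B, A). *)
Definition extremal_solution omega m n (A : 'M[R[i]]_m) (B : 'M[R[i]]_(m, n))
    (C : 'M[R[i]]_(n, m)) (D : 'M[R[i]]_n) (X : 'M[R[i]]_(m, n)) : Prop :=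
  are_solution A B C D X /\
  (forall lambda : R[i],
     eigenvalue (D - C *m X) lambda -> 0 < omega_re omega lambda).

End Riccati.

Section ADDA.
Variables (R : realType) (m n : nat).
Variables (A : 'M[R[i]]_m) (B : 'M[R[i]]_(m, n)).
Variables (C : 'M[R[i]]_(n, m)) (D : 'M[R[i]]_n).
Variables alpha beta : R[i].

Record adda_state := AddaState {
  adda_E : 'M[R[i]]_n;
  adda_F : 'M[R[i]]_m;
  adda_G : 'M[R[i]]_(n, m);
  adda_H : 'M[R[i]]_(m, n) }.

Definition adda_Abeta : 'M[R[i]]_m := A + beta%:M.
Definition adda_Dalpha : 'M[R[i]]_n := D + alpha%:M.
Definition adda_W : 'M[R[i]]_m := adda_Abeta - B *m invmx adda_Dalpha *m C.
Definition adda_V : 'M[R[i]]_n := adda_Dalpha - C *m invmx adda_Abeta *m B.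

Definition adda_init : adda_state := {|
  adda_E := 1%:M - (alpha + beta) *: invmx adda_V;
  adda_F := 1%:M - (alpha + beta) *: invmx adda_W;
  adda_G := (alpha + beta) *: (invmx adda_Dalpha *m C *m invmx adda_W);
  adda_H := (alpha + beta) *: (invmx adda_W *m B *m invmx adda_Dalpha) |}.

Definition adda_IGH (s : adda_state) : 'M[R[i]]_n :=
  1%:M - adda_G s *m adda_H s.
Definition adda_IHG (s : adda_state) : 'M[R[i]]_m :=
  1%:M - adda_H s *m adda_G s.

Definition adda_step (s : adda_state) : adda_state :=
  let: AddaState E F G H := s in
  let P := invmx (adda_IGH s) in
  let S := invmx (adda_IHG s) in
  {| adda_E := E *m P *m E;
     adda_F := F *m S *m F;
     adda_G := G + E *m P *m G *m F;
     adda_H := H + F *m S *m H *m E |}.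

Definition adda (k : nat) : adda_state := iter k adda_step adda_init.

(* [invmx] is total, so invertibility has to be recorded separately. *)
Definition adda_well_defined : Prop :=
  [/\ adda_Abeta \in unitmx, adda_Dalpha \in unitmx,
      adda_W \in unitmx, adda_V \in unitmx &
      forall k, adda_IGH (adda k) \in unitmx /\ adda_IHG (adda k) \in unitmx].

End ADDA.

(* Main.v *)
Require Import Defs.
From HB Require Import structures.
From mathcomp Require Import all_boot all_order all_algebra.
From mathcomp Require Import all_classical all_reals all_analysis.
From mathcomp Require Import complex.
From mathcomp Require Import ring lra.

Set Implicit Arguments.
Unset Strict Implicit.
Unset Printing Implicit Defensive.

Import Order.TTheory GRing.Theory Num.Theory.
Import numFieldNormedType.Exports.
Local Open Scope ring_scope.
Local Open Scope complex_scope.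

(** Write the Riccati equation as the invariance of the graph of X under the
    block operator [D, -C; B, -A], and Q = [D, -C; -B, A].  One ADDA state is a
    linear map sending an input pair (x, y) to the output pair
    (E x + G y, H x + F y), and a doubling step is the star product of this
    map with itself: one copy's outgoing wave is the other copy's incoming one.

    - Well-definedness.  Up to signs the initial map is
      (Q - diag(beta, alpha)) (Q + diag(alpha, beta))^-1
      ([adda_init_io]).  The bounds on t and gamma imply that
      |chi Q_ii - b| + q_i <= |b|, with b = beta on the rows of D and b = alpha
      on the rows of A, and the positivity of the rotated row excesses gives
      |chi Q_ii + a| > |a| + q_i for the other shift a
      ([cayley_shift_bounds]).  Reading both inequalities in a
      row where the solution of the shifted system has maximal modulus shows
      that, after scaling E by alpha / beta and F by beta / alpha, the initial
      map is a strict contraction for the maximum norm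
      ([adda_init_contractive]).  The star product of a strict contraction with
      itself is a contraction with the same constant ([contractive_double]),
      and the scaling is compatible with doubling.  In particular G_k and H_k
      have norm below 1, hence I - G_k H_k and I - H_k G_k are invertible.

    - Convergence.  Let M = (R - beta)(R + alpha)^-1 with R = chi (D - C Phi),
      and N = (S - alpha)(S + beta)^-1 with S = chi (A - B Psi).  The graphs of
      Phi and Psi give H_k + F_k Phi M^(2^k) = Phi and
      F_k + H_k Psi N^(2^k) = N^(2^k) ([double_invariant]), so that
      Phi - H_k = (I - H_k Psi) N^(2^k) Phi M^(2^k).
      The first factor stays bounded.  By a Gershgorin argument on Q, an
      eigenvalue of D - C Phi in the half plane that defines Phi lies in a
      disk of a row of D ([riccati_eigenvalue_disk]); the inequalities above
      then force every eigenvalue of (alpha / beta) M into the open unit disk,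
      and likewise for (beta / alpha) N ([cayley_eigenvalue_lt]).  The two
      scalings cancel in the product, which is therefore O(r^(2^k)) with
      r < 1 ([pow_growth]), and this is quadratic convergence in any norm
      ([quadratic_cvg_of_bound]). *)

(** * Modulus, rotated real part and the shift inequalities *)

Section Modulus.
Variable R : realType.
Implicit Types (z w : R[i]) (omega : R).

Lemma cmodE z : `|z| = (cmod z)%:C.
Proof. by rewrite /cmod normc_def. Qed.

Lemma cmod_ge0 z : 0 <= cmod z.
Proof. by rewrite -lecR -cmodE normr_ge0. Qed.

Lemma cmodM z w : cmod (z * w) = cmod z * cmod w.
Proof. by apply: (@complexI R); rewrite rmorphM /= -!cmodE normrM. Qed.

Lemma cmodN z : cmod (- z) = cmod z.
Proof. by apply: (@complexI R); rewrite -!cmodE normrN. Qed.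

Lemma cmod0 : cmod (0 : R[i]) = 0.
Proof. by apply: (@complexI R); rewrite -!cmodE normr0. Qed.

Lemma cmod1 : cmod (1 : R[i]) = 1.
Proof. by apply: (@complexI R); rewrite -!cmodE normr1. Qed.

Lemma cmod_eq0 z : (cmod z == 0) = (z == 0).
Proof. by rewrite -(inj_eq (@complexI R)) -cmodE normr_eq0. Qed.

Lemma cmod_gt0 z : (0 < cmod z) = (z != 0).
Proof. by rewrite lt_neqAle cmod_ge0 andbT eq_sym cmod_eq0. Qed.

Lemma cmodV z : cmod z^-1 = (cmod z)^-1.
Proof. by apply: (@complexI R); rewrite fmorphV /= -!cmodE normfV. Qed.

Lemma cmod_real (x : R) : cmod x%:C = `|x|.
Proof. by rewrite /cmod normc_def /= expr0n addr0 sqrtr_sqr. Qed.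

Lemma cmodD z w : cmod (z + w) <= cmod z + cmod w.
Proof. by rewrite -lecR rmorphD /= -!cmodE ler_normD. Qed.

Lemma cmodD_ge z w : cmod z - cmod w <= cmod (z + w).
Proof. by rewrite lerBlDr -{1}(addrK w z) -(cmodN w) cmodD. Qed.

Lemma cmod_sum (I : Type) (r : seq I) (P : pred I) (F : I -> R[i]) :
  cmod (\sum_(i <- r | P i) F i) <= \sum_(i <- r | P i) cmod (F i).
Proof.
elim/big_ind2: _ => [|x a y b xa yb|//]; first by rewrite cmod0.
exact: le_trans (cmodD _ _) (lerD xa yb).
Qed.

Lemma sqr_cmod z : cmod z ^+ 2 = complex.Re z ^+ 2 + complex.Im z ^+ 2.
Proof. by rewrite /cmod normc_def /= sqr_sqrtr // addr_ge0 ?sqr_ge0. Qed.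

Lemma omega_reD omega z w :
  omega_re omega (z + w) = omega_re omega z + omega_re omega w.
Proof. by case: z w => [a b] [c d]; rewrite /omega_re /=; ring. Qed.

Lemma varpiE omega : varpi omega = cmod (z_perp omega) ^+ 2.
Proof. by rewrite sqr_cmod. Qed.

Lemma cmod_z_perp_gt0 omega : 0 < cmod (z_perp omega).
Proof.
by rewrite cmod_gt0 eq_complex /=; apply/negP=> /andP[/eqP-> /eqP]; lra.
Qed.

Lemma cmod_z_perp_le1 omega : 0 <= omega <= 1 -> cmod (z_perp omega) <= 1.
Proof.
move=> /andP[om0 om1]; rewrite -(@expr_le1 _ 2) ?cmod_ge0 // -varpiE /varpi.
by nra.
Qed.

(** omega_re is the real scalar product with z_perp, so this is Cauchy-Schwarz. *)
Lemma omega_re_le omega z : omega_re omega z <= cmod (z_perp omega) * cmod z.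
Proof.
apply: le_trans (ler_norm _) _.
rewrite -(@ler_pXn2r _ 2) ?nnegrE ?mulr_ge0 ?cmod_ge0 //.
rewrite real_normK ?num_real // exprMn !sqr_cmod /omega_re /=.
rewrite -subr_ge0.
have H : forall a b o : R, (o ^+ 2 + (1 - o) ^+ 2) * (a ^+ 2 + b ^+ 2) -
   (o * a + (1 - o) * b) ^+ 2 = ((1 - o) * a - o * b) ^+ 2 by move=> *; ring.
by rewrite H; exact: sqr_ge0.
Qed.

Lemma omega_re_scale_z_perp omega (t : R) :
  omega_re omega (t%:C * z_perp omega) = t * varpi omega.
Proof. by rewrite /omega_re /varpi /=; ring. Qed.

Lemma sqr_cmodB_z_perp omega z (t : R) :
  cmod (z - t%:C * z_perp omega) ^+ 2 =
  cmod z ^+ 2 - 2 * t * omega_re omega z + t ^+ 2 * varpi omega.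
Proof. by case: z => a b; rewrite !sqr_cmod /omega_re /varpi /=; ring. Qed.

(** The hypothesis on t is what completing the square in
    |d - t z|^2 <= (t |z| - q / |z|)^2 requires, where z = z_perp omega.  The
    base on the right is nonnegative: since |z| |d| >= omega_re d > q, the same
    hypothesis yields t |z|^2 >= (omega_re d + q) / 2 > q.
    As |z| <= 1, q / |z| may be weakened to q. *)
Lemma cayley_shift_bounds omega d (q t : R) : 0 <= omega <= 1 -> 0 <= q ->
  0 < omega_re omega d - q ->
  (varpi omega * cmod d ^+ 2 - q ^+ 2) /
    (2 * varpi omega * (omega_re omega d - q)) <= t ->
  [/\ 0 < t,
      cmod (d - t%:C * z_perp omega) + q <= cmod (t%:C * z_perp omega) &
      forall s : R, 0 < s ->
        cmod (s%:C * z_perp omega) + q < cmod (d + s%:C * z_perp omega)].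
Proof.
move=> o01 q0 dq.
set z := z_perp omega; have s0 := cmod_z_perp_gt0 omega.
have s1 := cmod_z_perp_le1 o01; have wE := varpiE omega.
have w0 : 0 < varpi omega by rewrite wE exprn_gt0.
have dle := omega_re_le omega d.
rewrite ler_pdivrMr; last by rewrite !mulr_gt0.
move=> ht.
set e := omega_re omega d in dq dle ht *.
set s := cmod (z_perp omega) in s0 s1 wE dle *.
have tw : q < t * varpi omega.
  have : e ^+ 2 <= varpi omega * cmod d ^+ 2.
    by rewrite wE -exprMn ler_pXn2r ?nnegrE ?mulr_ge0 ?cmod_ge0 //; lra.
  move=> h.
  have : (e - q) * (e + q) <= (e - q) * (2 * (t * varpi omega)) by lra.
  by rewrite ler_pM2l //; lra.
have t0 : 0 < t by rewrite -(pmulr_lgt0 _ w0); lra.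
have ct r : 0 < r -> cmod (r%:C * z) = r * s.
  by move=> r0; rewrite cmodM cmod_real gtr0_norm.
have qs : q <= q / s by rewrite ler_peMr // invf_ge1.
split=> //.
- rewrite ct //; suff: cmod (d - t%:C * z) <= t * s - q / s by lra.
  have ts : 0 <= t * s - q / s.
    by rewrite subr_ge0 ler_pdivrMr // -mulrA -expr2 -wE ltW.
  rewrite -(@ler_pXn2r _ 2) ?nnegrE ?cmod_ge0 // sqr_cmodB_z_perp -/e.
  have -> : (t * s - q / s) ^+ 2 = t ^+ 2 * varpi omega - 2 * t * q +
      q ^+ 2 / varpi omega by rewrite wE; field; lra.
  suff : cmod d ^+ 2 - 2 * t * (e - q) <= q ^+ 2 / varpi omega by lra.
  by rewrite ler_pdivlMr //; lra.
- move=> r r0; rewrite ct // -(ltr_pM2l s0).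
  apply: lt_le_trans (omega_re_le _ _); rewrite omega_reD omega_re_scale_z_perp.
  rewrite -/e wE; have : s * q <= q by rewrite ler_piMl.
  by rewrite mulrDr [s * (r * s)]mulrCA -expr2; lra.
Qed.

End Modulus.

(** * Maximum norm, contractive states and the star product *)

Section MaxNorm.
Variable R : realType.
Local Notation C := R[i].

(** On column vectors this is the supremum norm, for which diagonal dominance
    is a contraction estimate; it is used on all matrices so that several
    inputs can be processed at once, one per column. *)
Definition mxnorm m n (X : 'M[C]_(m, n)) : R :=
  \big[Num.max/0]_(ij : 'I_m * 'I_n) cmod (X ij.1 ij.2).

Lemma mxnorm_ge0 m n (X : 'M[C]_(m, n)) : 0 <= mxnorm X.
Proof. exact: bigmax_ge_id. Qed.

Lemma cmod_le_mxnorm m n (X : 'M[C]_(m, n)) i j : cmod (X i j) <= mxnorm X.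
Proof. exact: (le_bigmax _ (fun ij => cmod (X ij.1 ij.2)) (i, j)). Qed.

Lemma mxnorm_le m n (X : 'M[C]_(m, n)) (c : R) : 0 <= c ->
  (forall i j, cmod (X i j) <= c) -> mxnorm X <= c.
Proof. by move=> c0 h; apply: bigmax_le => // -[i j] _; apply: h. Qed.

Lemma mxnorm_attained m n (X : 'M[C]_(m, n)) : 0 < mxnorm X ->
  exists i j, mxnorm X = cmod (X i j).
Proof.
rewrite /mxnorm; elim/big_ind: _; first by rewrite ltxx.
- move=> x y hx hy; rewrite /Num.max; case: ifP => _; [exact: hy|exact: hx].
- by move=> [i j] _ _; exists i, j.
Qed.

Lemma mxnorm0 m n : mxnorm (0 : 'M[C]_(m, n)) = 0.
Proof.
by apply/eqP; rewrite eq_le mxnorm_ge0 andbT mxnorm_le // => i j; rewrite mxE cmod0.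
Qed.

Lemma mxnorm_eq0 m n (X : 'M[C]_(m, n)) : mxnorm X = 0 -> X = 0.
Proof.
move=> X0; apply/matrixP=> i j; apply/eqP; rewrite mxE -cmod_eq0.
by rewrite eq_le cmod_ge0 andbT -X0 cmod_le_mxnorm.
Qed.

Lemma mxnormN m n (X : 'M[C]_(m, n)) : mxnorm (- X) = mxnorm X.
Proof. by apply: eq_bigr => ij _; rewrite mxE cmodN. Qed.

Lemma mxnormD m n (X Y : 'M[C]_(m, n)) : mxnorm (X + Y) <= mxnorm X + mxnorm Y.
Proof.
apply: mxnorm_le => [|i j]; first by rewrite addr_ge0 ?mxnorm_ge0.
by rewrite mxE (le_trans (cmodD _ _)) ?lerD ?cmod_le_mxnorm.
Qed.

Lemma mxnormZ m n a (X : 'M[C]_(m, n)) : mxnorm (a *: X) <= cmod a * mxnorm X.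
Proof.
apply: mxnorm_le => [|i j]; first by rewrite mulr_ge0 ?mxnorm_ge0 ?cmod_ge0.
by rewrite mxE cmodM ler_wpM2l ?cmod_ge0 ?cmod_le_mxnorm.
Qed.

Lemma mxnormM m n p (X : 'M[C]_(m, n)) (Y : 'M[C]_(n, p)) :
  mxnorm (X *m Y) <= n%:R * mxnorm X * mxnorm Y.
Proof.
apply: mxnorm_le => [|i j]; first by rewrite !mulr_ge0 ?mxnorm_ge0.
rewrite mxE; apply: le_trans (cmod_sum _ _ _) _.
have -> : n%:R * mxnorm X * mxnorm Y = \sum_(k < n) mxnorm X * mxnorm Y.
  by rewrite sumr_const card_ord -mulrA mulr_natl.
apply: ler_sum => k _; by rewrite cmodM ler_pM ?cmod_ge0 ?cmod_le_mxnorm.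
Qed.

Lemma mxnorm1 n : mxnorm (1%:M : 'M[C]_n) <= 1.
Proof.
by apply: mxnorm_le => // i j; rewrite mxE; case: (i == j); rewrite ?cmod1 ?cmod0.
Qed.

Lemma unitmx_of_trivial_kernel n (M : 'M[C]_n) :
  (forall v : 'cV[C]_n, M *m v = 0 -> v = 0) -> M \in unitmx.
Proof.
move=> h; rewrite -unitmx_tr -row_free_unit -kermx_eq0.
apply/eqP/row_matrixP => i; rewrite row0.
apply: trmx_inj; rewrite trmx0; apply: h.
by rewrite -{1}[M]trmxK -trmx_mul -row_mul mulmx_ker row0 trmx0.
Qed.

(** [eigenvalue] speaks of row vectors, the graph of a Riccati solution of columns. *)
Lemma eigenvalue_col n (M : 'M[C]_n) a : eigenvalue M a ->
  exists2 v : 'cV[C]_n, v != 0 & M *m v = a *: v.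
Proof.
move=> Ma; apply: contrapT => nv.
have : M - a%:M \in unitmx.
  apply: unitmx_of_trivial_kernel => v; rewrite mulmxBl mul_scalar_mx => /eqP.
  rewrite subr_eq0 => /eqP Mv; apply/eqP/negPn/negP => v0.
  by apply: nv; exists v.
by rewrite -row_free_unit -kermx_eq0; move: Ma; rewrite /eigenvalue => /negPf ->.
Qed.

(** The inputs may have any number of columns, so that the identity matrix is an
    admissible input: it turns the estimate into a bound on G and H. *)
Definition contractive m n (c : R) (E : 'M[C]_n) (F : 'M[C]_m)
    (G : 'M[C]_(n, m)) (H : 'M[C]_(m, n)) : Prop :=
  forall l (x : 'M[C]_(n, l)) (y : 'M[C]_(m, l)),
    mxnorm (E *m x + G *m y) <= c * Num.max (mxnorm x) (mxnorm y) /\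
    mxnorm (H *m x + F *m y) <= c * Num.max (mxnorm x) (mxnorm y).

Lemma contractive_sym m n c (E : 'M[C]_n) (F : 'M[C]_m)
    (G : 'M[C]_(n, m)) (H : 'M[C]_(m, n)) :
  contractive c E F G H -> contractive c F E H G.
Proof.
move=> h l x y; have [h1 h2] := h l y x.
by rewrite maxC addrC [G *m _ + _]addrC.
Qed.

Section Star.
Variables (m n : nat) (c : R) (E : 'M[C]_n) (F : 'M[C]_m).
Variables (G : 'M[C]_(n, m)) (H : 'M[C]_(m, n)).
Hypotheses (c1 : c < 1) (hc : contractive c E F G H).

Lemma contractive_G l (y : 'M[C]_(m, l)) : mxnorm (G *m y) <= c * mxnorm y.
Proof.
have [+ _] := hc 0 y; rewrite mulmx0 add0r mxnorm0.
by rewrite (max_idPr (mxnorm_ge0 y)).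
Qed.

Lemma contractive_H l (x : 'M[C]_(n, l)) : mxnorm (H *m x) <= c * mxnorm x.
Proof.
have [_ ] := hc x 0; rewrite mulmx0 addr0 mxnorm0.
by rewrite (max_idPl (mxnorm_ge0 x)).
Qed.

Lemma contractive_IGH_unit : 1%:M - G *m H \in unitmx.
Proof.
apply: unitmx_of_trivial_kernel => v; rewrite mulmxBl mul1mx => /eqP.
rewrite subr_eq0 => /eqP vE; apply: mxnorm_eq0; apply/eqP.
rewrite eq_le mxnorm_ge0 andbT leNgt; apply/negP => v0; have := contractive_H v; have := contractive_G (H *m v).
rewrite mulmxA -vE; set a := mxnorm v in v0 *; set b := mxnorm _ => h1 h2.
have : c * b <= 1 * b by rewrite ler_wpM2r ?mxnorm_ge0 // ltW.
have : c * a < 1 * a by rewrite ltr_pM2r.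
by lra.
Qed.
End Star.

Lemma contractive_IHG_unit m n (c : R) (E : 'M[C]_n) (F : 'M[C]_m) G H :
  c < 1 -> contractive c E F G H -> 1%:M - H *m G \in unitmx.
Proof. by move=> c1 /contractive_sym/contractive_IGH_unit; apply. Qed.

Lemma push_through m n (G : 'M[C]_(n, m)) (H : 'M[C]_(m, n)) :
  1%:M - G *m H \in unitmx -> 1%:M - H *m G \in unitmx ->
  H *m invmx (1%:M - G *m H) = invmx (1%:M - H *m G) *m H.
Proof.
move=> uP uS; apply: (can_inj (mulKmx uS)); rewrite mulKVmx // mulmxA.
have -> : (1%:M - H *m G) *m H = H *m (1%:M - G *m H).
  by rewrite mulmxBl mulmxBr mul1mx mulmx1 mulmxA.
by rewrite mulmxK.
Qed.

(** Cascading the state with itself: x1 and y1 are the values exchanged between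
    the two copies.  They solve the two coupled equations, and the updated
    blocks return the outer outputs of the cascade. *)
Lemma star_inner m n l (E : 'M[C]_n) (F : 'M[C]_m)
    (G : 'M[C]_(n, m)) (H : 'M[C]_(m, n)) (x : 'M[C]_(n, l)) (y : 'M[C]_(m, l)) :
  1%:M - G *m H \in unitmx -> 1%:M - H *m G \in unitmx ->
  let P := invmx (1%:M - G *m H) in
  let S := invmx (1%:M - H *m G) in
  let x1 := P *m (E *m x + G *m (F *m y)) in
  let y1 := S *m (H *m (E *m x) + F *m y) in
  [/\ x1 = E *m x + G *m y1, y1 = H *m x1 + F *m y,
      E *m P *m E *m x + (G + E *m P *m G *m F) *m y = E *m x1 + G *m y &
      (H + F *m S *m H *m E) *m x + F *m S *m F *m y = H *m x + F *m y1].
Proof.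
move=> uP uS P S x1 y1.
have HP : H *m P = S *m H by exact: push_through.
have GS : G *m S = P *m G by rewrite push_through.
have PE : P = 1%:M + P *m G *m H.
  have := mulVmx uP; rewrite -/P mulmxBr mulmx1 mulmxA => /eqP.
  by rewrite subr_eq => /eqP.
have SE : S = 1%:M + S *m H *m G.
  have := mulVmx uS; rewrite -/S mulmxBr mulmx1 mulmxA => /eqP.
  by rewrite subr_eq => /eqP.
split.
- rewrite /x1 /y1 [G *m (S *m _)]mulmxA GS mulmxDr [RHS]addrC mulmxDr !mulmxA.
  by rewrite addrAC; congr (_ + _); rewrite {1}PE mulmxDl mulmxDl mul1mx addrC.
- rewrite /x1 /y1 [H *m (P *m _)]mulmxA HP !mulmxDr !mulmxA -addrA; congr (_ + _).
  by rewrite {1}SE mulmxDl mulmxDl mul1mx addrC.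
- by rewrite /x1 mulmxDl !mulmxDr !mulmxA -!addrA; congr (_ + _); rewrite addrC.
- by rewrite /y1 mulmxDl !mulmxDr !mulmxA -!addrA.
Qed.

(** If one of the exchanged values x1, y1 exceeded the outer inputs, the coupled
    equations would bound it by c < 1 times the larger of the two, which is
    absurd; so both inner values are dominated by the outer inputs, and one
    more application of the contraction bounds the outputs. *)
Lemma contractive_double m n (c : R) (E : 'M[C]_n) (F : 'M[C]_m)
    (G : 'M[C]_(n, m)) (H : 'M[C]_(m, n)) : 0 <= c -> c < 1 ->
  contractive c E F G H ->
  let P := invmx (1%:M - G *m H) in
  let S := invmx (1%:M - H *m G) in
  contractive c (E *m P *m E) (F *m S *m F)
    (G + E *m P *m G *m F) (H + F *m S *m H *m E).
Proof.
move=> c0 c1 hc P S l x y.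
have [] := star_inner E F x y (contractive_IGH_unit c1 hc)
  (contractive_IHG_unit c1 hc).
rewrite -/P -/S; set x1 := P *m _; set y1 := S *m _ => xE yE -> ->.
set M := Num.max _ _.
have xM : mxnorm x <= M by rewrite le_max lexx.
have yM : mxnorm y <= M by rewrite le_max lexx orbT.
have M0 : 0 <= M by exact: le_trans (mxnorm_ge0 x) xM.
clearbody M.
have [hx _] := hc _ x y1; have [_ hy] := hc _ x1 y.
rewrite -xE -yE in hx hy.
have cM : c * M <= M by rewrite ler_piMl // ltW.
have cmul a b : 0 <= b -> a <= c * b -> a <= b.
  by move=> b0 /le_trans; apply; rewrite ler_piMl // ltW.
set a := mxnorm x1 in hx hy; set b := mxnorm y1 in hx hy.
have a0 : 0 <= a by exact: mxnorm_ge0. have b0 : 0 <= b by exact: mxnorm_ge0.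
have gt0 u : 0 <= u -> M < u -> c * u < u.
  by move=> u0 Mu; rewrite -[ltRHS]mul1r ltr_pM2r //; apply: le_lt_trans Mu.
have maxM : a <= M /\ b <= M.
  have aM : a <= c * Num.max M b.
    by apply: le_trans hx _; rewrite ler_wpM2l // ge_max !le_max lexx xM orbT.
  have bM : b <= c * Num.max M a.
    by apply: le_trans hy _; rewrite ler_wpM2l // ge_max !le_max lexx yM orbT.
  case: (leP M b) aM => Mb; case: (leP M a) bM => Ma h1 h2.
  - have : c * b <= b by rewrite ler_piMl // ltW.
    have : c * a <= a by rewrite ler_piMl // ltW.
    move=> h3 h4; have ab : a = b by apply/eqP; rewrite eq_le; lra.
    split; rewrite leNgt; apply/negP => /gt0.
      by move=> /(_ a0); rewrite ab in h1 h2 *; lra.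
    by move=> /(_ b0); rewrite ab in h1 h2 *; lra.
  - have : b <= M by lra.
    by lra.
  - have : c * b <= c * M by rewrite ler_wpM2l // ltW.
    by move=> _; split; lra.
  - by split; lra.
have [aM bM] := maxM.
have [h1 _] := hc _ x1 y; have [_ h2] := hc _ x y1.
split; [apply: le_trans h1 _|apply: le_trans h2 _];
  by rewrite ler_wpM2l // ge_max ?xM ?yM ?aM ?bM.
Qed.

Lemma scaled_sandwich (K : fieldType) n (s : K) (E P : 'M[K]_n) :
  (s *: E) *m P *m (s *: E) = s ^+ 2 *: (E *m P *m E).
Proof. by rewrite -!scalemxAl -!scalemxAr scalerA. Qed.

Lemma scaled_cross (K : fieldType) m n (s s' : K) (E P : 'M[K]_n)
    (G : 'M[K]_(n, m)) (F : 'M[K]_m) : s * s' = 1 ->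
  (s *: E) *m P *m G *m (s' *: F) = E *m P *m G *m F.
Proof. by move=> ss'; rewrite -!scalemxAl -!scalemxAr scalerA ss' scale1r. Qed.

(** E_k behaves like the 2^k-th power of a matrix that may expand, and F_k
    compensates.  Scaling E by s and F by its inverse leaves G and H
    unchanged under doubling and squares s. *)
Lemma contractive_double_scaled m n (c : R) (s : C) (E : 'M[C]_n) (F : 'M[C]_m)
    (G : 'M[C]_(n, m)) (H : 'M[C]_(m, n)) : 0 <= c -> c < 1 -> s != 0 ->
  contractive c (s *: E) (s^-1 *: F) G H ->
  let P := invmx (1%:M - G *m H) in
  let S := invmx (1%:M - H *m G) in
  contractive c (s ^+ 2 *: (E *m P *m E)) ((s ^+ 2)^-1 *: (F *m S *m F))
    (G + E *m P *m G *m F) (H + F *m S *m H *m E).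
Proof.
move=> c0 c1 s0 hc P S; have := contractive_double c0 c1 hc.
rewrite /= -/P -/S; move: P S => P S.
have s1 : s * s^-1 = 1 by rewrite divff.
have s1' : s^-1 * s = 1 by rewrite mulVf.
have s2 : s^-1 ^+ 2 = (s ^+ 2)^-1 by rewrite exprVn.
by rewrite !scaled_sandwich (scaled_cross _ _ _ _ s1) (scaled_cross _ _ _ _ s1') s2.
Qed.

(** Feeding the input (I, X M^2), for which x1 = M and y1 = X M are the inner
    values, through the cascade. *)
Lemma double_invariant m n (E : 'M[C]_n) (F : 'M[C]_m)
    (G : 'M[C]_(n, m)) (H : 'M[C]_(m, n)) (M : 'M[C]_n) (X : 'M[C]_(m, n)) :
  1%:M - G *m H \in unitmx -> 1%:M - H *m G \in unitmx ->
  E + G *m X *m M = M -> H + F *m X *m M = X ->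
  let P := invmx (1%:M - G *m H) in
  let S := invmx (1%:M - H *m G) in
  E *m P *m E + (G + E *m P *m G *m F) *m X *m (M *m M) = M *m M /\
  H + F *m S *m H *m E + F *m S *m F *m X *m (M *m M) = X.
Proof.
move=> uP uS eM eX P S.
have [] := star_inner E F 1%:M (X *m (M *m M)) uP uS.
rewrite -/P -/S !mulmx1 -![_ *m X *m (M *m M)]mulmxA.
set x1 := P *m _; set y1 := S *m _ => _ _ -> ->.
have x1E : x1 = M.
  have : (1%:M - G *m H) *m M = E + G *m F *m X *m M *m M.
    rewrite mulmxBl mul1mx -{1}eM -addrA; congr (_ + _).
    rewrite -{1}eX mulmxDr mulmxDl !mulmxA addrC addKr //.
  by move=> h; rewrite /x1 !mulmxA -h mulKmx.
have y1E : y1 = X *m M.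
  have : (1%:M - H *m G) *m (X *m M) = H *m E + F *m X *m M *m M.
    rewrite mulmxBl mul1mx -{1}eX mulmxDl -{1}eM mulmxDr !mulmxA.
    by rewrite addrAC addrK.
  by move=> h; rewrite /y1 !mulmxA -h mulKmx.
rewrite x1E y1E; split; last by rewrite mulmxA.
by rewrite !mulmxA -mulmxDl eM.
Qed.

End MaxNorm.

(** * Growth of matrix powers and quadratic convergence *)

Section Growth.
Local Open Scope classical_set_scope.
Local Open Scope ring_scope.
Variable R : realType.
Local Notation C := R[i].

(** Induction on the factors: v_k = A^k B satisfies v_(k+1) = z v_k + w_k, where
    w_k = A^k (A - z) B is covered by the shorter product, and a perturbation
    of size r'^k of a recursion with factor |z| < r' keeps the growth r'^k. *)
Lemma pow_bound_annihilated n (A : 'M[C]_n.+1) (r r' : R) (s : seq C) :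
  0 <= r -> r < r' -> {in s, forall z, cmod z <= r} ->
  forall B : 'M[C]_n.+1, (\prod_(z <- s) (A - z%:M)) * B = 0 ->
  exists2 K, 0 <= K & forall k, mxnorm (A ^+ k * B) <= K * r' ^+ k.
Proof.
move=> r0 rr'; elim/last_ind: s => [|s z IH] sr B.
  rewrite big_nil mul1r => ->; exists 0 => // k.
  by rewrite mulr0 mxnorm0 mul0r.
rewrite -cats1 big_cat /= big_seq1 -mulrA => /IH [w ws|K K0 hK].
  by apply: sr; rewrite mem_rcons inE ws orbT.
have zr : cmod z <= r by apply: sr; rewrite mem_rcons inE eqxx.
(* L r' >= r L + K is what the induction step needs; the first term covers
   k = 0. *)
pose L := mxnorm B + K / (r' - r).
have rr0 : 0 < r' - r by rewrite subr_gt0.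
have L0 : 0 <= L by rewrite addr_ge0 ?mxnorm_ge0 ?divr_ge0 // ltW.
exists L => //; elim=> [|k IHk].
  by rewrite expr0 mul1r mulr1 lerDl divr_ge0 // ltW.
have -> : A ^+ k.+1 * B = z *: (A ^+ k * B) + A ^+ k * ((A - z%:M) * B).
  rewrite exprSr -mulrA mulrBl -mul_scalar_mx mulrBr mulmxE.
  by rewrite -!mulmxE mul_scalar_mx !mul_scalar_mx -scalemxAr addrC subrK.
apply: le_trans (mxnormD _ _) _.
have h1 := le_trans (mxnormZ z _) (ler_pM (cmod_ge0 z) (mxnorm_ge0 _) zr IHk).
apply: le_trans (lerD h1 (hK k)) _.
have -> : L * r' ^+ k.+1 = (L * r') * r' ^+ k by rewrite exprS mulrA.
have -> : r * (L * r' ^+ k) + K * r' ^+ k = (r * L + K) * r' ^+ k by ring.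
rewrite ler_wpM2r ?exprn_ge0 ?(le_trans r0) ?(ltW rr') //.
have : K <= L * (r' - r).
  by rewrite mulrDl divfK ?gt_eqF // lerDr mulr_ge0 ?mxnorm_ge0 // ltW.
by lra.
Qed.

(** By Cayley-Hamilton the product of the A - z over the roots z of the
    characteristic polynomial vanishes, so the previous bound applies to B = 1
    with any rate strictly above the spectral radius. *)
Lemma pow_growth n (A : 'M[C]_n) :
  (forall a, eigenvalue A a -> cmod a < 1) ->
  exists r K, [/\ 0 < r, r < 1, 0 <= K &
    forall k, mxnorm (A ^+ k) <= K * r ^+ k].
Proof.
case: n A => [|n] A hA.
  exists (1 / 2), 0; split=> [|||k] //; try lra.
  by rewrite mul0r [A ^+ k]flatmx0 mxnorm0.
have [s sE] := closed_field_poly_normal (char_poly A).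
have /monicP lc := char_poly_monic A; rewrite lc scale1r in sE.
have hs : {in s, forall z, cmod z < 1}.
  move=> z zs; apply: hA; rewrite eigenvalue_root_char sE.
  by rewrite root_prod_XsubC.
pose r0 := \big[Num.max/0]_(z <- s) cmod z.
have r01 : r0 < 1.
  rewrite /r0 big_seq; elim/big_ind: _ => // x y x1 y1.
  by rewrite gt_max x1 y1.
have r00 : 0 <= r0 by exact: bigmax_ge_id.
have CH : \prod_(z <- s) (A - z%:M) = 0.
  rewrite -(Cayley_Hamilton A) sE rmorph_prod /=.
  by apply: eq_bigr => z _; rewrite rmorphB /= horner_mx_X horner_mx_C.
have [||z zs||K K0 hK] := @pow_bound_annihilated _ A r0 ((r0 + 1) / 2) s _ _ _ 1.
- by [].
- lra.
- by rewrite /r0; apply: le_bigmax_seq.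
- by rewrite mulr1.
exists ((r0 + 1) / 2), K; split=> [|||k] //; try lra.
by have := hK k; rewrite mulr1.
Qed.

(** Expand X on the elementary matrices. *)
Lemma norm_le_mxnorm m n (N : 'M[C]_(m, n) -> R) : is_norm N ->
  exists2 K, 0 <= K & forall X, 0 <= N X <= K * mxnorm X.
Proof.
move=> [ND NZ _].
have N0 : N 0 = 0 by rewrite -(scale0r 0) NZ cmod0 mul0r.
have N_ge0 X : 0 <= N X.
  have NN : N (- X) = N X by rewrite -scaleN1r NZ cmodN cmod1 mul1r.
  by have := ND X (- X); rewrite subrr N0 NN; lra.
exists (\sum_i \sum_j N (delta_mx i j)) => [|X].
  by apply: sumr_ge0 => i _; apply: sumr_ge0.
rewrite N_ge0 /= {1}[X]matrix_sum_delta.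
have Nsum (I : finType) (F : I -> 'M[C]_(m, n)) : N (\sum_i F i) <= \sum_i N (F i).
  elim/big_ind2: _ => [|x a y b xa yb|//]; first by rewrite N0.
  exact: le_trans (ND _ _) (lerD xa yb).
apply: le_trans (Nsum _ _) _; rewrite mulr_suml ler_sum // => i _.
apply: le_trans (Nsum _ _) _; rewrite mulr_suml ler_sum // => j _.
by rewrite NZ mulrC ler_wpM2l // cmod_le_mxnorm.
Qed.

Lemma limn_esup_le_near (u : nat -> \bar R) (l : \bar R) :
  (\forall k \near \oo, u k <= l)%E -> (limn_esup u <= l)%E.
Proof.
move=> [k0 _ hk]; rewrite limn_esup_lim.
apply: lime_le; first exact: is_cvg_esups.
exists k0 => // k /= kk; apply: ge_ereal_sup => _ [j /= kj <-].
by apply: hk => /=; apply: leq_trans kj.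
Qed.

(** Any r' strictly between r and 1 absorbs the constant from some rank on, since
    K (r / r')^(2^k) tends to 0; then the 2^k-th roots are eventually below r'. *)
Lemma quadratic_cvg_of_bound m n (X : nat -> 'M[C]_(m, n)) L (K r : R) :
  0 <= K -> 0 < r -> r < 1 ->
  (forall k, mxnorm (X k - L) <= K * r ^+ (2 ^ k)) -> quadratic_cvg X L.
Proof.
move=> K0 r0 r1 hX N /norm_le_mxnorm [KN KN0 hN].
pose r' := (r + 1) / 2.
have r'0 : 0 < r' by rewrite /r'; lra.
have r'1 : r' < 1 by rewrite /r'; lra.
pose q := r / r'.
have q1 : q < 1 by rewrite /q ltr_pdivrMr // mul1r /r'; lra.
have q0 : 0 < q by rewrite divr_gt0.
apply: (@le_lt_trans _ _ r'%:E); last by rewrite lte_fin.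
apply: limn_esup_le_near.
have ev : \forall k \near \oo, KN * K * q ^+ k <= 1.
  have : (KN * K * q ^+ k @[k --> \oo] --> (KN * K * 0 : R))%classic.
    by apply: cvgM; [exact: cvg_cst|apply: cvg_expr; rewrite ger0_norm // ltW].
  rewrite mulr0 => /cvgr0_norm_le /(_ 1 ltr01); apply: filterS => k.
  by apply: le_trans; exact: ler_norm.
apply: filterS ev => k hk; rewrite lee_fin.
have /andP[N0 NX] := hN (X k - L).
have kq : q ^+ (2 ^ k) <= q ^+ k.
  apply: ler_wiXn2l; [exact: ltW|exact: ltW|by rewrite ltnW // ltn_expl].
have bd : N (X k - L) <= r' ^+ (2 ^ k).
  apply: le_trans NX _; apply: le_trans (ler_wpM2l KN0 (hX k)) _.
  have -> : r = q * r' by rewrite divfK ?gt_eqF.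
  rewrite exprMn !mulrA -[leRHS]mul1r ler_wpM2r ?exprn_ge0 ?(ltW r'0) //.
  by apply: le_trans hk; rewrite ler_wpM2l ?mulr_ge0.
have e0 : 0 <= ((2 ^+ k)^-1 : R) by rewrite invr_ge0 exprn_ge0.
apply: le_trans (ge0_ler_powR e0 _ _ bd) _; rewrite ?nnegrE ?exprn_ge0 ?(ltW r'0) //.
rewrite -powR_mulrn ?(ltW r'0) // -powRrM natrX divff ?powRr1 ?(ltW r'0) //.
Qed.

End Growth.

(** * Diagonal dominance *)

Section Dominance.
Variable R : realType.
Local Notation C := R[i].

(** The sum q_i of the theorem.  The pair (D, K) stands for the blocks (D, C) of
    Q or, in the lower rows, for (A, B). *)
Definition block_radius n m (D : 'M[C]_n) (K : 'M[C]_(n, m)) (i : 'I_n) : R :=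
  offdiag_sum D i + \sum_j cmod (K i j).

Lemma offdiag_sum_ge0 n (D : 'M[C]_n) i : 0 <= offdiag_sum D i.
Proof. by apply: sumr_ge0 => j _; apply: cmod_ge0. Qed.

Lemma block_radius_ge0 n m (D : 'M[C]_n) (K : 'M[C]_(n, m)) i :
  0 <= block_radius D K i.
Proof.
by rewrite addr_ge0 ?offdiag_sum_ge0 // sumr_ge0 // => j _; exact: cmod_ge0.
Qed.

Lemma offdiag_sum_lshift n m (A : 'M[C]_m) B (K : 'M[C]_(n, m)) D i :
  offdiag_sum (are_mx A B K D) (lshift m i) = block_radius D K i.
Proof.
rewrite /offdiag_sum /block_radius /are_mx big_split_ord /=; congr (_ + _).
  by apply: eq_big => [j|j _]; rewrite ?block_mxEul // (inj_eq (@lshift_inj _ _)).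
apply: eq_big => [j|j _]; first by rewrite eq_rlshift.
by rewrite block_mxEur mxE cmodN.
Qed.

Lemma offdiag_sum_rshift n m (A : 'M[C]_m) B (K : 'M[C]_(n, m)) D i :
  offdiag_sum (are_mx A B K D) (rshift n i) = block_radius A B i.
Proof.
rewrite /offdiag_sum /block_radius /are_mx big_split_ord /= addrC; congr (_ + _).
  by apply: eq_big => [j|j _]; rewrite ?block_mxEdr // (inj_eq (@rshift_inj _ _)).
apply: eq_big => [j|j _]; first by rewrite eq_lrshift.
by rewrite block_mxEdl mxE cmodN.
Qed.

Lemma block_radiusZ n m (a : C) (D : 'M[C]_n) (K : 'M[C]_(n, m)) i :
  block_radius (a *: D) (a *: K) i = cmod a * block_radius D K i.
Proof.
rewrite /block_radius /offdiag_sum mulrDr !mulr_sumr.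
by congr (_ + _); apply: eq_bigr => j _; rewrite mxE cmodM.
Qed.

Lemma row_defect n m l (D : 'M[C]_n) (K : 'M[C]_(n, m)) (a : C)
    (p : 'M[C]_(n, l)) (q : 'M[C]_(m, l)) i k :
  cmod (((D + a%:M) *m p - K *m q) i k - (D i i + a) * p i k) <=
  block_radius D K i * Num.max (mxnorm p) (mxnorm q).
Proof.
set N := Num.max _ _.
have pN j : cmod (p j k) <= N by rewrite le_max cmod_le_mxnorm.
have qN j : cmod (q j k) <= N by rewrite le_max cmod_le_mxnorm orbT.
have -> : ((D + a%:M) *m p - K *m q) i k - (D i i + a) * p i k =
    \sum_(j | j != i) D i j * p j k - \sum_j K i j * q j k.
  rewrite mulmxDl mul_scalar_mx !mxE (bigD1 i) //= mulrDl.
  by ring.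
apply: le_trans (cmodD _ _) _; rewrite cmodN mulrDl.
apply: lerD; apply: le_trans (cmod_sum _ _ _) _; rewrite mulr_suml;
  by apply: ler_sum => j _; rewrite cmodM ler_wpM2l ?cmod_ge0.
Qed.

Lemma row_upper n m l (D : 'M[C]_n) (K : 'M[C]_(n, m)) (a : C)
    (p : 'M[C]_(n, l)) (q : 'M[C]_(m, l)) i k :
  cmod (((D + a%:M) *m p - K *m q) i k) <=
  (cmod (D i i + a) + block_radius D K i) * Num.max (mxnorm p) (mxnorm q).
Proof.
have := row_defect D K a p q i k; set x := (((D + a%:M) *m p - K *m q) i k) => h.
rewrite -[x](subrK ((D i i + a) * p i k)).
apply: le_trans (cmodD _ _) _; rewrite [leRHS]mulrDl [leRHS]addrC lerD //.
by rewrite cmodM ler_wpM2l ?cmod_ge0 // le_max cmod_le_mxnorm.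
Qed.

Lemma row_lower n m l (D : 'M[C]_n) (K : 'M[C]_(n, m)) (a : C)
    (p : 'M[C]_(n, l)) (q : 'M[C]_(m, l)) i k :
  cmod (D i i + a) * cmod (p i k) <=
  cmod (((D + a%:M) *m p - K *m q) i k) +
  block_radius D K i * Num.max (mxnorm p) (mxnorm q).
Proof.
have := row_defect D K a p q i k; set x := (((D + a%:M) *m p - K *m q) i k) => h.
rewrite -cmodM; have -> : (D i i + a) * p i k = x - (x - (D i i + a) * p i k).
  by rewrite subKr.
by apply: le_trans (cmodD _ _) _; rewrite cmodN lerD.
Qed.

(** The Gershgorin argument: evaluate the system in a row where the pair (p, q)
    reaches its maximal modulus. *)
Lemma extremal_row n m l (A : 'M[C]_m) (B : 'M[C]_(m, n)) (K : 'M[C]_(n, m))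
    (D : 'M[C]_n) (a b : C) (p : 'M[C]_(n, l)) (q : 'M[C]_(m, l)) :
  let N := Num.max (mxnorm p) (mxnorm q) in
  0 < N ->
  (exists i, cmod (D i i + a) * N <=
     mxnorm ((D + a%:M) *m p - K *m q) + block_radius D K i * N) \/
  (exists i, cmod (A i i + b) * N <=
     mxnorm ((A + b%:M) *m q - B *m p) + block_radius A B i * N).
Proof.
move=> N N0; case: (leP (mxnorm q) (mxnorm p)) => qp.
- have NE : N = mxnorm p by apply/max_idPl.
  left; rewrite NE in N0; have [i [k ik]] := mxnorm_attained N0.
  exists i; rewrite {1}NE {1}ik.
  by apply: le_trans (row_lower D K a p q i k) _; rewrite lerD2r cmod_le_mxnorm.
- have NE : N = mxnorm q by apply/max_idPr/ltW.
  right; rewrite NE in N0; have [i [k ik]] := mxnorm_attained N0.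
  exists i; rewrite {1}NE {1}ik /N maxC.
  by apply: le_trans (row_lower A B b q p i k) _; rewrite lerD2r cmod_le_mxnorm.
Qed.

Lemma dominant_unitmx n (D : 'M[C]_n) a :
  (forall i, offdiag_sum D i < cmod (D i i + a)) -> D + a%:M \in unitmx.
Proof.
move=> h; apply: unitmx_of_trivial_kernel => v v0; apply: mxnorm_eq0.
apply/eqP; rewrite eq_le mxnorm_ge0 andbT leNgt; apply/negP => v_gt0.
have [i [k ik]] := mxnorm_attained v_gt0.
have := row_lower D (0 : 'M[C]_(n, n)) a v 0 i k.
rewrite mul0mx subr0 v0 mxE cmod0 add0r mxnorm0 (max_idPl (mxnorm_ge0 v)) -ik.
rewrite ler_pM2r // /block_radius big1 => [|j _]; last by rewrite mxE cmod0.
by rewrite addr0 leNgt h.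
Qed.

Lemma uniform_strict_bound (I : finType) (f : I -> R) : (forall i, f i < 1) ->
  exists c, [/\ 0 <= c, c < 1 & forall i, f i <= c].
Proof.
move=> h; exists (\big[Num.max/0]_i f i); split.
- exact: bigmax_ge_id.
- by elim/big_ind: _ => // x y x1 y1; rewrite gt_max x1 y1.
- by move=> i; apply: (le_bigmax _ f).
Qed.

(** The row inequalities behind the method: subtracting b moves the
    diagonal entry into the disk of radius |b|, adding a moves it out of the disk
    of radius |a|, in both cases with room to absorb the off-diagonal part. *)
Definition shift_dominant n m (D : 'M[C]_n) (K : 'M[C]_(n, m)) (a b : C) : Prop :=
  forall i, cmod (D i i - b) + block_radius D K i <= cmod b /\
            cmod a + block_radius D K i < cmod (D i i + a).

Lemma shift_dominant_ratio n m (D : 'M[C]_n) (K : 'M[C]_(n, m)) (a b : C) :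
  shift_dominant D K a b -> exists c, [/\ 0 <= c, c < 1 &
    forall i, cmod a <= c * (cmod (D i i + a) - block_radius D K i)].
Proof.
move=> h; pose g i := cmod (D i i + a) - block_radius D K i.
have g0 i : cmod a < g i by have [_] := h i; rewrite /g; lra.
have g1 i : 0 < g i by apply: le_lt_trans (g0 i); exact: cmod_ge0.
have [|c [c0 c1 hc]] := @uniform_strict_bound _ (fun i => cmod a / g i).
  by move=> i; rewrite ltr_pdivrMr // mul1r.
by exists c; split=> // i; have := hc i; rewrite ler_pdivrMr.
Qed.

Lemma shift_dominant_unitmx n m (D : 'M[C]_n) (K : 'M[C]_(n, m)) (a b : C) :
  shift_dominant D K a b -> D + a%:M \in unitmx.
Proof.
move=> h; apply: dominant_unitmx => i; have [_] := h i; rewrite /block_radius.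
have := cmod_ge0 a; have : 0 <= \sum_j cmod (K i j).
  by apply: sumr_ge0 => j _; apply: cmod_ge0.
by lra.
Qed.

(** Scaling the right-hand sides by a and b makes both rows of blocks
    contractive with one constant. *)
Lemma shifted_solve_bound n m (A : 'M[C]_m) (B : 'M[C]_(m, n)) (K : 'M[C]_(n, m))
    (D : 'M[C]_n) (a b : C) : a != 0 -> b != 0 ->
  shift_dominant D K a b -> shift_dominant A B b a ->
  exists c, [/\ 0 <= c, c < 1 &
    forall l (p x : 'M[C]_(n, l)) (q y : 'M[C]_(m, l)),
      (D + a%:M) *m p - K *m q = a *: x -> (A + b%:M) *m q - B *m p = b *: y ->
      Num.max (mxnorm p) (mxnorm q) <= c * Num.max (mxnorm x) (mxnorm y)].
Proof.
move=> a0 b0 /shift_dominant_ratio[c [c0 c1 hc]].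
move=> /shift_dominant_ratio[d [d0 d1 hd]].
exists (Num.max c d); split; [by rewrite le_max c0|by rewrite gt_max c1|].
move=> l p x q y xE yE; set N := Num.max (mxnorm p) _; set M := Num.max (mxnorm x) _.
have xM : mxnorm x <= M by rewrite le_max lexx.
have yM : mxnorm y <= M by rewrite le_max lexx orbT.
have M0 : 0 <= M by apply: le_trans xM; exact: mxnorm_ge0.
have key (z : C) (e u r : R) : z != 0 -> 0 <= e -> e <= Num.max c d -> 0 < N ->
    cmod z <= e * (u - r) -> u * N <= cmod z * M + r * N -> N <= Num.max c d * M.
  move=> z0 e0 eM N0 h1 h2; apply: (@le_trans _ _ (e * M)); last exact: ler_wpM2r.
  have zp : 0 < cmod z by rewrite cmod_gt0.
  have h3 : cmod z * N <= e * (u - r) * N by rewrite ler_wpM2r // ltW.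
  have h4 : e * ((u - r) * N) <= e * (cmod z * M) by rewrite ler_wpM2l //; lra.
  by rewrite -(ler_pM2l zp); lra.
case: (leP N 0) => N0.
  by apply: le_trans N0 _; rewrite mulr_ge0 // le_max c0.
case: (extremal_row A B K D a b N0) => -[i hi].
- apply: (key a c _ _ a0 c0 _ N0 (hc i)); first by rewrite le_max lexx.
  apply: le_trans hi _; rewrite lerD2r xE.
  by apply: le_trans (mxnormZ _ _) _; rewrite ler_wpM2l ?cmod_ge0.
- apply: (key b d _ _ b0 d0 _ N0 (hd i)); first by rewrite le_max lexx orbT.
  apply: le_trans hi _; rewrite lerD2r yE.
  by apply: le_trans (mxnormZ _ _) _; rewrite ler_wpM2l ?cmod_ge0.
Qed.

(** W is a Schur complement of the shifted matrix Q, so a kernel vector of W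
    extends to a kernel vector of that matrix, which is excluded by dominance. *)
Lemma adda_W_unitmx n m (A : 'M[C]_m) (B : 'M[C]_(m, n)) (K : 'M[C]_(n, m))
    (D : 'M[C]_n) (a b : C) : a != 0 -> b != 0 ->
  shift_dominant D K a b -> shift_dominant A B b a ->
  adda_W A B K D a b \in unitmx.
Proof.
move=> a0 b0 hD hA; apply: unitmx_of_trivial_kernel => v Wv.
have uD : D + a%:M \in unitmx := shift_dominant_unitmx hD.
have [c [_ _ hc]] := shifted_solve_bound a0 b0 hD hA.
have := hc _ (invmx (D + a%:M) *m (K *m v)) 0 v 0.
rewrite mulKVmx // subrr !scaler0 => /(_ erefl).
have -> : (A + b%:M) *m v - B *m (invmx (D + a%:M) *m (K *m v)) = 0.
  by rewrite -Wv /adda_W /adda_Abeta /adda_Dalpha [in RHS]mulmxBl !mulmxA.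
move=> /(_ erefl); rewrite !mxnorm0 maxxx mulr0 ge_max => /andP[_ v0].
by apply: mxnorm_eq0; apply/eqP; rewrite eq_le v0 mxnorm_ge0.
Qed.

(** If v is an eigenvector of D - K X then (v, X v) is an eigenvector of
    [D, -K; B, -A], and Gershgorin places lambda in a disk around some D_ii
    unless it lies in one around some - A_ii. *)
Lemma riccati_eigenvalue_disk n m (A : 'M[C]_m) (B : 'M[C]_(m, n))
    (K : 'M[C]_(n, m)) (D : 'M[C]_n) (X : 'M[C]_(m, n)) lambda :
  are_solution A B K D X -> eigenvalue (D - K *m X) lambda ->
  (forall i, block_radius A B i < cmod (A i i + lambda)) ->
  exists i, cmod (lambda - D i i) <= block_radius D K i.
Proof.
move=> sol /eigenvalue_col[v v0 vE] hA.
have h1 : (D + (- lambda)%:M) *m v - K *m (X *m v) = 0.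
  rewrite raddfN /= mulmxDl mulNmx mul_scalar_mx mulmxA addrAC -mulmxBl vE.
  by rewrite subrr.
have h2 : (A + lambda%:M) *m (X *m v) - B *m v = 0.
  rewrite mulmxDl mul_scalar_mx scalemxAr -vE !mulmxA -mulmxDl -mulmxBl.
  rewrite mulmxBr mulmxA.
  have -> : A *m X + (X *m D - X *m K *m X) - B =
      - (X *m K *m X - X *m D - A *m X + B).
    by rewrite !opprD !opprK; apply/matrixP => i j; rewrite !mxE; ring.
  by rewrite sol oppr0 mul0mx.
set N := Num.max (mxnorm v) (mxnorm (X *m v)).
have N0 : 0 < N.
  rewrite lt_max lt_neqAle mxnorm_ge0 andbT eq_sym; apply/orP; left.
  by apply: contra_neq v0; apply: mxnorm_eq0.
case: (extremal_row A B K D (- lambda) lambda N0) => -[i +].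
  by rewrite h1 mxnorm0 add0r ler_pM2r // => h; exists i; rewrite -cmodN opprB.
by rewrite h2 mxnorm0 add0r ler_pM2r // leNgt hA.
Qed.

Lemma eigenvalueN_unitmx n (M : 'M[C]_n) a :
  ~~ eigenvalue M (- a) -> M + a%:M \in unitmx.
Proof.
rewrite /eigenvalue negbK kermx_eq0 row_free_unit.
by rewrite raddfN /= opprK.
Qed.

Definition cayley n (M : 'M[C]_n) (a b : C) : 'M[C]_n :=
  (M - b%:M) *m invmx (M + a%:M).

(** An eigenvalue mu of the scaled transform satisfies
    mu = (a / b) (z - b) / (z + a) for an eigenvalue z of M, where
    |z - b| <= |b| and |z + a| > |a|. *)
Lemma cayley_eigenvalue_lt n (M : 'M[C]_n) (a b mu : C) :
  a != 0 -> b != 0 -> a + b != 0 ->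
  (forall z, eigenvalue M z -> cmod (z - b) <= cmod b /\ cmod a < cmod (z + a)) ->
  eigenvalue ((a / b) *: cayley M a b) mu -> cmod mu < 1.
Proof.
move=> a0 b0 ab hM /eigenvalueP[v vE v0].
have uM : M + a%:M \in unitmx.
  apply: eigenvalueN_unitmx; apply/negP => /hM[_]; rewrite addNr cmod0.
  by rewrite ltNge cmod_ge0.
(* nu is the eigenvalue of the unscaled transform; nu = 1 would force
   a + b = 0. *)
pose nu := b / a * mu.
have {vE} vE : v *m (M - b%:M) = nu *: (v *m (M + a%:M)).
  have vc : v *m cayley M a b = nu *: v.
    move: vE; rewrite -scalemxAr => vE.
    have ba : b / a * (a / b) = 1 by field; rewrite a0 b0.
    by rewrite /nu -scalerA -vE scalerA ba scale1r.
  by rewrite scalemxAl -vc /cayley mulmxA mulmxKV.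
have {}vE : (1 - nu) *: (v *m M) = (b + nu * a) *: v.
  move: vE; rewrite mulmxBr mulmxDr !mul_mx_scalar scalerDr scalerA => /eqP.
  rewrite subr_eq => /eqP; move: (v *m M) => x e; rewrite scalerBl scale1r {1}e.
  by apply/matrixP => i j; rewrite !mxE; ring.
case: (eqVneq nu 1) vE => [->|nu1] vE.
  move: vE; rewrite subrr scale0r mul1r => /esym/eqP.
  by rewrite scaler_eq0 (negPf v0) orbF addrC (negPf ab).
have nu1' : 1 - nu != 0 by rewrite subr_eq0 eq_sym.
pose z := (b + nu * a) / (1 - nu).
have [|z1 z2] := hM z.
  apply/eigenvalueP; exists v => //.
  by rewrite /z mulrC -scalerA -vE scalerA mulVf // scale1r.
have zE : z - b = nu * (z + a) by rewrite /z; field.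
move: z1; rewrite zE cmodM => z1.
have muE : mu = nu * a / b by rewrite /nu; field; rewrite a0 b0.
rewrite muE cmodM cmodV [cmod (nu * a)]cmodM ltr_pdivrMr ?cmod_gt0 // mul1r.
case: (eqVneq nu 0) => [->|nu0]; first by rewrite cmod0 mul0r cmod_gt0.
by apply: lt_le_trans z1; rewrite ltr_pM2l ?cmod_gt0.
Qed.

End Dominance.

(** * The initial state *)

Section Doubling.
Variable R : realType.
Local Notation C := R[i].
Variables (m n : nat).
Variables (A : 'M[C]_m) (B : 'M[C]_(m, n)) (K : 'M[C]_(n, m)) (D : 'M[C]_n).
Variables alpha beta : C.

Let Da := adda_Dalpha D alpha.
Let Ab := adda_Abeta A beta.
Let V := adda_V A B K D alpha beta.
Let W := adda_W A B K D alpha beta.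
Let s0 := adda_init A B K D alpha beta.

(** Parametrizing inputs by (p, q) removes all inverses: the initial state sends
    (D p - K q + alpha p, B p - A q - beta q) to
    (D p - K q - beta p, B p - A q + alpha q). *)
Lemma adda_init_io l (p : 'M[C]_(n, l)) (q : 'M[C]_(m, l)) :
  Da \in unitmx -> Ab \in unitmx -> V \in unitmx -> W \in unitmx ->
  let x := Da *m p - K *m q in
  let y := B *m p - Ab *m q in
  adda_E s0 *m x + adda_G s0 *m y = x - (alpha + beta) *: p /\
  adda_H s0 *m x + adda_F s0 *m y = y + (alpha + beta) *: q.
Proof.
move=> uD uA uV uW x y; set e := alpha + beta.
have VE : V = Da - K *m invmx Ab *m B by [].
have WE : W = Ab - B *m invmx Da *m K by [].
(* The two expressions of the corner of the inverse of the shifted Q. *)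
have VK : invmx V *m K *m invmx Ab = invmx Da *m K *m invmx W.
  apply: (can_inj (mulKmx uV)); rewrite !mulmxA mulmxV // mul1mx.
  apply: (can_inj (mulmxK uW)); rewrite mulmxKV // VE WE.
  by rewrite mulmxBr mulmxKV // !mulmxBl mulmxV // mul1mx !mulmxA.
have Vx : invmx V *m x = p + invmx V *m K *m invmx Ab *m y.
  have : V *m p = x - K *m invmx Ab *m y.
    rewrite VE /x /y mulmxBl mulmxBr opprB !mulmxA mulmxKV //.
    by apply/matrixP => i j; rewrite !mxE; ring.
  by move=> /(congr1 (mulmx (invmx V))); rewrite mulKmx // mulmxBr !mulmxA => ->;
    rewrite subrK.
have Wy : invmx W *m B *m invmx Da *m x = q + invmx W *m y.
  have : W *m q = B *m invmx Da *m x - y.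
    rewrite WE /x /y mulmxBl mulmxBr !mulmxA mulmxKV //.
    by apply/matrixP => i j; rewrite !mxE; ring.
  by move=> /(congr1 (mulmx (invmx W))); rewrite mulKmx // mulmxBr !mulmxA => ->;
    rewrite subrK.
rewrite /s0 /adda_init /= -/Da -/Ab -/V -/W -/e; split.
- rewrite mulmxBl mul1mx -!scalemxAl Vx -VK scalerDr opprD addrA subrK //.
- rewrite mulmxBl mul1mx -!scalemxAl Wy scalerDr.
  by rewrite addrC [_ *: q + _]addrC addrA subrK.
Qed.

Hypotheses (alpha0 : alpha != 0) (beta0 : beta != 0).
Hypothesis hD : shift_dominant D K alpha beta.
Hypothesis hA : shift_dominant A B beta alpha.

Let uD : Da \in unitmx := shift_dominant_unitmx hD.
Let uA : Ab \in unitmx := shift_dominant_unitmx hA.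
Let uW : W \in unitmx := adda_W_unitmx alpha0 beta0 hD hA.
Let uV : V \in unitmx := adda_W_unitmx beta0 alpha0 hA hD.

Lemma adda_init_contractive : exists c, [/\ 0 <= c, c < 1 &
  contractive c ((alpha / beta) *: adda_E s0) ((alpha / beta)^-1 *: adda_F s0)
    (adda_G s0) (adda_H s0)].
Proof.
have [c [c0 c1 hc]] := shifted_solve_bound alpha0 beta0 hD hA.
exists c; split=> // l x y.
pose q := invmx W *m (B *m invmx Da *m (alpha *: x) - beta *: y).
pose p := invmx Da *m (alpha *: x + K *m q).
have xE : Da *m p - K *m q = alpha *: x by rewrite mulKVmx // addrK.
have WE : W = Ab - B *m invmx Da *m K by [].
have yE : Ab *m q - B *m p = beta *: (- y).
  have : W *m q = B *m invmx Da *m (alpha *: x) - beta *: y by rewrite mulKVmx.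
  rewrite WE mulmxBl /p => /eqP; rewrite subr_eq => /eqP ->.
  rewrite mulmxDr mulmxDr !mulmxA scalerN.
  by apply/matrixP => i j; rewrite !mxE; ring.
have pqN := hc _ _ _ _ _ xE yE; rewrite mxnormN in pqN.
have [] := adda_init_io p q uD uA uV uW.
move: (adda_E s0) (adda_F s0) (adda_G s0) (adda_H s0) => E F G H.
rewrite xE; have -> : B *m p - Ab *m q = beta *: y by rewrite -opprB yE scalerN opprK.
rewrite -!scalemxAr => EG HF.
have e1 : beta * (alpha / beta) = alpha by field.
have e2 : alpha * (alpha / beta)^-1 = beta by field; rewrite alpha0 beta0.
(* One proof for both outputs: the output is b^-1 times a row of blocks whose
   diagonal is shifted by - b. *)
have upper k k' (M : 'M[C]_k) (L : 'M[C]_(k, k')) (u : 'M[C]_(k, l))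
    (v : 'M[C]_(k', l)) (a b : C) (Z : 'M[C]_(k, l)) :
    b != 0 -> shift_dominant M L a b -> b *: Z = (M + (- b)%:M) *m u - L *m v ->
    Num.max (mxnorm u) (mxnorm v) <= c * Num.max (mxnorm x) (mxnorm y) ->
    mxnorm Z <= c * Num.max (mxnorm x) (mxnorm y).
  move=> b0 hM bZ uvN; have -> : Z = b^-1 *: (b *: Z) by rewrite scalerA mulVf // scale1r.
  apply: le_trans (mxnormZ _ _) _; rewrite cmodV mulrC ler_pdivrMr ?cmod_gt0 //.
  rewrite mulrC; apply: mxnorm_le => [|i k''].
    by rewrite mulr_ge0 ?cmod_ge0 // (le_trans _ uvN) // le_max mxnorm_ge0.
  rewrite bZ; apply: le_trans (row_upper _ _ _ _ _ _ _) _.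
  have [h _] := hM i.
  apply: ler_pM => //; last by rewrite le_max mxnorm_ge0.
  by rewrite addr_ge0 ?cmod_ge0 ?block_radius_ge0.
split.
- apply: (upper _ _ D K p q alpha beta) => //.
  rewrite -scalemxAl scalerDr scalerA e1 EG -xE.
  rewrite /Da /adda_Dalpha !mulmxDl !mul_scalar_mx.
  by apply/matrixP => i j; rewrite !mxE; ring.
- rewrite -mxnormN; apply: (upper _ _ A B q p beta alpha) => //; last by rewrite maxC.
  rewrite scalerN -scalemxAl scalerDr scalerA e2 HF.
  rewrite -[beta *: y]opprK -scalerN -yE.
  rewrite /Ab /adda_Abeta !mulmxDl !mul_scalar_mx.
  by apply/matrixP => i j; rewrite !mxE; ring.
Qed.

(** On the graph of X, take p = (R + alpha)^-1 and q = X p with R = D - K X; the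
    input is then (I, X M). *)
Lemma adda_init_invariant (X : 'M[C]_(m, n)) :
  are_solution A B K D X -> (D - K *m X) + alpha%:M \in unitmx ->
  let M := cayley (D - K *m X) alpha beta in
  adda_E s0 + adda_G s0 *m X *m M = M /\ adda_H s0 + adda_F s0 *m X *m M = X.
Proof.
move=> sol uR M; set T := D - K *m X in uR M *.
pose p := invmx (T + alpha%:M).
have [] := adda_init_io p (X *m p) uD uA uV uW.
move: (adda_E s0) (adda_F s0) (adda_G s0) (adda_H s0) => E F G H.
have xE : Da *m p - K *m (X *m p) = 1%:M.
  by rewrite mulmxA -mulmxBl /Da /adda_Dalpha addrAC mulmxV.
have yE : B *m p - Ab *m (X *m p) = X *m M.
  rewrite /M /cayley -/p !mulmxA -mulmxBl; congr (_ *m _).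
  apply/eqP; rewrite -subr_eq0 /T /Ab /adda_Abeta !mulmxDl !mul_scalar_mx.
  rewrite !mulmxBr mul_mx_scalar !mulmxA -[X in _ == X]sol; apply/eqP.
  by apply/matrixP => i j; rewrite !mxE; ring.
clearbody T.
rewrite xE yE !mulmx1 [G *m _]mulmxA [F *m _]mulmxA => -> ->; split.
- rewrite -[1%:M](mulmxV uR) -/p -mul_scalar_mx -mulmxBl /M /cayley -/p.
  congr (_ *m _); rewrite raddfD /=.
  by apply/matrixP => i j; rewrite !mxE; ring.
- rewrite -[RHS]mulmx1 -(mulmxV uR) -/p /M /cayley -/p.
  rewrite -mul_scalar_mx !mulmxA -mulmxDl; congr (_ *m _).
  rewrite mul_scalar_mx mulmxBr mulmxDr !mul_mx_scalar.
  by apply/matrixP => i j; rewrite !mxE; ring.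
Qed.

(** On the graph of Y, take q = - (S + beta)^-1 and p = Y q with S = A - B Y; the
    input is then (Y N, I). *)
Lemma adda_init_dual_invariant (Y : 'M[C]_(n, m)) :
  are_solution D K B A Y -> (A - B *m Y) + beta%:M \in unitmx ->
  let N := cayley (A - B *m Y) beta alpha in
  adda_F s0 + adda_H s0 *m Y *m N = N /\ adda_G s0 + adda_E s0 *m Y *m N = Y.
Proof.
move=> sol uR N; set T := A - B *m Y in uR N *.
pose q := - invmx (T + beta%:M).
have [] := adda_init_io (Y *m q) q uD uA uV uW.
move: (adda_E s0) (adda_F s0) (adda_G s0) (adda_H s0) => E F G H.
have yE : B *m (Y *m q) - Ab *m q = 1%:M.
  rewrite mulmxA -mulmxBl /Ab /adda_Abeta /q mulmxN -mulNmx opprB addrAC.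
  by rewrite mulmxV.
have xE : Da *m (Y *m q) - K *m q = Y *m N.
  rewrite /N /cayley !mulmxA -mulmxBl /q mulmxN -mulNmx; congr (_ *m _).
  apply/eqP; rewrite -subr_eq0 /T /Da /adda_Dalpha !mulmxDl !mul_scalar_mx.
  rewrite !mulmxBr mul_mx_scalar !mulmxA -[X in _ == X]sol.
  apply/eqP; by apply/matrixP => i j; rewrite !mxE; ring.
clearbody T.
rewrite xE yE !mulmx1 [E *m _]mulmxA [H *m _]mulmxA.
rewrite addrC [_ + F]addrC => -> ->; split.
- rewrite -[1%:M](mulmxV uR) -mul_scalar_mx /q mulmxN -mulmxBl /N /cayley.
  congr (_ *m _); rewrite raddfD /=.
  by apply/matrixP => i j; rewrite !mxE; ring.
- rewrite -[RHS]mulmx1 -(mulmxV uR) /N /cayley /q.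
  rewrite -mul_scalar_mx !mulmxA mulmxN opprK -mulmxDl; congr (_ *m _).
  rewrite mul_scalar_mx mulmxBr mulmxDr !mul_mx_scalar.
  by apply/matrixP => i j; rewrite !mxE; ring.
Qed.

End Doubling.

(** * Iterates and convergence *)

Section Convergence.
Variable R : realType.
Local Notation C := R[i].

Lemma expr_double n (M : 'M[C]_n) k : M ^+ (2 ^ k.+1) = M ^+ (2 ^ k) *m M ^+ (2 ^ k).
Proof. by rewrite expnS mul2n -addnn exprD mulmxE. Qed.

Lemma exprmxZ n (a : C) (M : 'M[C]_n) k : (a *: M) ^+ k = a ^+ k *: M ^+ k.
Proof.
elim: k => [|k IH]; first by rewrite !expr0 scale1r.
by rewrite !exprS IH -!mulmxE -scalemxAl -scalemxAr scalerA.
Qed.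

(** The two identities give X - H_k = (I - H_k Y) N^(2^k) X M^(2^k); the factors s
    and its inverse cancel in this product, so only the spectra of s M and
    N / s matter. *)
Lemma doubling_cvg m n (F : nat -> 'M[C]_m) (H : nat -> 'M[C]_(m, n))
    (X : 'M[C]_(m, n)) (Y : 'M[C]_(n, m)) (M : 'M[C]_n) (N : 'M[C]_m) (s : C) :
  s != 0 ->
  (forall k, H k + F k *m X *m M ^+ (2 ^ k) = X) ->
  (forall k, F k + H k *m Y *m N ^+ (2 ^ k) = N ^+ (2 ^ k)) ->
  (forall k, mxnorm (H k) <= 1) ->
  (forall a, eigenvalue (s *: M) a -> cmod a < 1) ->
  (forall a, eigenvalue (s^-1 *: N) a -> cmod a < 1) ->
  quadratic_cvg H X.
Proof.
move=> s0 hX hF hH /pow_growth[r1 [K1 [r10 r11 K10 hM]]].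
move=> /pow_growth[r2 [K2 [r20 r21 K20 hN]]].
pose L := m%:R * (1 + n%:R * mxnorm Y) * (n%:R * (m%:R * K2 * mxnorm X) * K1).
apply: (@quadratic_cvg_of_bound _ _ _ _ _ L (r2 * r1)).
- by rewrite !mulr_ge0 ?addr_ge0 ?mulr_ge0 ?mxnorm_ge0.
- by rewrite mulr_gt0.
- by rewrite -[ltRHS]mul1r ltr_pM // ltW.
move=> k; set j := (2 ^ k)%N.
pose T := (s^-1 *: N) ^+ j *m X *m (s *: M) ^+ j.
have TE : T = N ^+ j *m X *m M ^+ j.
  rewrite /T !exprmxZ -!scalemxAl -!scalemxAr scalerA.
  by rewrite exprVn mulVf ?scale1r // expf_neq0.
have HXE : H k - X = - ((1%:M - H k *m Y) *m T).
  have FE : F k = (1%:M - H k *m Y) *m N ^+ j.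
    by rewrite mulmxBl mul1mx -{1}(hF k) addrK.
  by rewrite -{1}[X](hX k) opprD addrA subrr sub0r FE TE !mulmxA.
rewrite HXE mxnormN; apply: le_trans (mxnormM _ _) _.
have b1 : mxnorm (1%:M - H k *m Y) <= 1 + n%:R * mxnorm Y.
  apply: le_trans (mxnormD _ _) _; rewrite mxnormN lerD ?mxnorm1 //.
  apply: le_trans (mxnormM _ _) _; rewrite ler_wpM2r ?mxnorm_ge0 //.
  by rewrite ler_piMr.
have b2 : mxnorm T <= n%:R * (m%:R * (K2 * r2 ^+ j) * mxnorm X) * (K1 * r1 ^+ j).
  apply: le_trans (mxnormM _ _) _.
  apply: ler_pM => //; rewrite ?mulr_ge0 ?mxnorm_ge0 //.
  rewrite ler_wpM2l //; apply: le_trans (mxnormM _ _) _.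
  by rewrite ler_wpM2r ?mxnorm_ge0 // ler_wpM2l.
apply: (@le_trans _ _ (m%:R * (1 + n%:R * mxnorm Y) *
    (n%:R * (m%:R * (K2 * r2 ^+ j) * mxnorm X) * (K1 * r1 ^+ j)))).
  apply: ler_pM => //; rewrite ?mulr_ge0 ?mxnorm_ge0 //.
  by rewrite ler_wpM2l.
by rewrite /L exprMn le_eqVlt; apply/orP; left; apply/eqP; ring.
Qed.

Lemma mxnorm_contractive_G m n c (E : 'M[C]_n) (F : 'M[C]_m)
    (G : 'M[C]_(n, m)) (H : 'M[C]_(m, n)) :
  0 <= c -> c < 1 -> contractive c E F G H -> mxnorm G <= 1.
Proof.
move=> c0 c1 hc; rewrite -[G]mulmx1; apply: le_trans (contractive_G hc _) _.
by rewrite mulr_ile1 ?mxnorm_ge0 ?mxnorm1 // ltW.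
Qed.

Section Iterates.
Variables (m n : nat).
Variables (A : 'M[C]_m) (B : 'M[C]_(m, n)) (K : 'M[C]_(n, m)) (D : 'M[C]_n).
Variables alpha beta : C.
Hypotheses (alpha0 : alpha != 0) (beta0 : beta != 0).
Hypothesis hD : shift_dominant D K alpha beta.
Hypothesis hA : shift_dominant A B beta alpha.
Let S := adda A B K D alpha beta.
Let sigma := alpha / beta.

Lemma adda_contractive : exists c, [/\ 0 <= c, c < 1 & forall k,
  contractive c (sigma ^+ (2 ^ k) *: adda_E (S k))
    ((sigma ^+ (2 ^ k))^-1 *: adda_F (S k)) (adda_G (S k)) (adda_H (S k))].
Proof.
have [c [c0 c1 hc]] := adda_init_contractive alpha0 beta0 hD hA.
have sg0 : sigma != 0 by rewrite mulf_neq0 ?invr_eq0.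
exists c; split; [exact: c0|exact: c1|].
elim=> [|k IH]; first by rewrite expn0 expr1; exact: hc.
have s0 : sigma ^+ (2 ^ k) != 0 by rewrite expf_neq0.
have := contractive_double_scaled c0 c1 s0 IH.
rewrite -exprM -expnSr /S /adda iterS -/(adda _ _ _ _ _ _ k) -/S.
by case: (S k).
Qed.

Lemma adda_inner_unitmx k :
  adda_IGH (S k) \in unitmx /\ adda_IHG (S k) \in unitmx.
Proof.
have [c [c0 c1 /(_ k) hc]] := adda_contractive.
by split; [exact: (contractive_IGH_unit c1 hc)|exact: (contractive_IHG_unit c1 hc)].
Qed.

Lemma adda_well_defined_dominant : adda_well_defined A B K D alpha beta.
Proof.
split.
- exact: shift_dominant_unitmx hA.
- exact: shift_dominant_unitmx hD.
- exact: adda_W_unitmx.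
- exact: (adda_W_unitmx beta0 alpha0 hA hD).
- exact: adda_inner_unitmx.
Qed.

Lemma adda_invariant (X : 'M[C]_(m, n)) (M : 'M[C]_n) k :
  adda_E (S 0) + adda_G (S 0) *m X *m M = M ->
  adda_H (S 0) + adda_F (S 0) *m X *m M = X ->
  adda_E (S k) + adda_G (S k) *m X *m M ^+ (2 ^ k) = M ^+ (2 ^ k) /\
  adda_H (S k) + adda_F (S k) *m X *m M ^+ (2 ^ k) = X.
Proof.
move=> h1 h2; elim: k => [|k [IH1 IH2]]; first by rewrite expn0 expr1.
have [u1 u2] := adda_inner_unitmx k.
rewrite expr_double.
have := double_invariant u1 u2 IH1 IH2.
by rewrite /S /adda iterS -/(adda _ _ _ _ _ _ k) -/S; case: (S k).
Qed.

Lemma adda_dual_invariant (Y : 'M[C]_(n, m)) (N : 'M[C]_m) k :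
  adda_F (S 0) + adda_H (S 0) *m Y *m N = N ->
  adda_G (S 0) + adda_E (S 0) *m Y *m N = Y ->
  adda_F (S k) + adda_H (S k) *m Y *m N ^+ (2 ^ k) = N ^+ (2 ^ k) /\
  adda_G (S k) + adda_E (S k) *m Y *m N ^+ (2 ^ k) = Y.
Proof.
move=> h1 h2; elim: k => [|k [IH1 IH2]]; first by rewrite expn0 expr1.
have [u1 u2] := adda_inner_unitmx k.
rewrite expr_double.
have := double_invariant u2 u1 IH1 IH2.
by rewrite /S /adda iterS -/(adda _ _ _ _ _ _ k) -/S; case: (S k).
Qed.

Lemma adda_quadratic_cvg (X : 'M[C]_(m, n)) (Y : 'M[C]_(n, m)) :
  alpha + beta != 0 ->
  are_solution A B K D X -> are_solution D K B A Y ->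
  (forall z, eigenvalue (D - K *m X) z ->
     cmod (z - beta) <= cmod beta /\ cmod alpha < cmod (z + alpha)) ->
  (forall z, eigenvalue (A - B *m Y) z ->
     cmod (z - alpha) <= cmod alpha /\ cmod beta < cmod (z + beta)) ->
  quadratic_cvg (fun k => adda_H (S k)) X /\
  quadratic_cvg (fun k => adda_G (S k)) Y.
Proof.
move=> ab solX solY eX eY.
have unit k (T : 'M[C]_k) (a b : C) : (forall z, eigenvalue T z ->
     cmod (z - b) <= cmod b /\ cmod a < cmod (z + a)) -> T + a%:M \in unitmx.
  move=> eT; apply: eigenvalueN_unitmx; apply/negP => /eT[_].
  by rewrite addNr cmod0 ltNge cmod_ge0.
have [M1 M2] := adda_init_invariant alpha0 beta0 hD hA solX (unit _ _ _ _ eX).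
have [N1 N2] := adda_init_dual_invariant alpha0 beta0 hD hA solY (unit _ _ _ _ eY).
have [c [c0 c1 hc]] := adda_contractive.
have inv k := adda_invariant k M1 M2.
have dinv k := adda_dual_invariant k N1 N2.
have sM := cayley_eigenvalue_lt alpha0 beta0 ab eX.
have ba : beta + alpha != 0 by rewrite addrC.
have sN := cayley_eigenvalue_lt beta0 alpha0 ba eY.
have sg0 : sigma != 0 by rewrite mulf_neq0 ?invr_eq0.
have sgV : beta / alpha = sigma^-1 by rewrite invf_div.
split.
- apply: (doubling_cvg sg0 (fun k => (inv k).2) (fun k => (dinv k).1)).
  + by move=> k; exact: mxnorm_contractive_G c0 c1 (contractive_sym (hc k)).
  + by move=> a; exact: sM.
  + by move=> a; rewrite -sgV; exact: sN.
- have sg0' : sigma^-1 != 0 by rewrite invr_eq0.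
  apply: (doubling_cvg sg0' (fun k => (dinv k).2) (fun k => (inv k).1)).
  + by move=> k; exact: mxnorm_contractive_G c0 c1 (hc k).
  + by move=> a; rewrite -sgV; exact: sN.
  + by move=> a; rewrite invrK; exact: sM.
Qed.

End Iterates.

(** The half plane that singles out the extremal solution excludes the disks
    around the - A_ii, so the eigenvalue is in a disk around some D_ii.  Unlike
    the half plane, this disk is compatible with the rotation by chi. *)
Lemma extremal_eigenvalue_bounds m n (A : 'M[C]_m) (B : 'M[C]_(m, n))
    (K : 'M[C]_(n, m)) (D : 'M[C]_n) (X : 'M[C]_(m, n)) omega (chi a b : C) :
  0 <= omega <= 1 -> cmod chi = 1 ->
  (forall i, block_radius A B i < omega_re omega (A i i)) ->
  extremal_solution omega A B K D X ->
  shift_dominant (chi *: D) (chi *: K) a b ->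
  forall z, eigenvalue (chi *: D - (chi *: K) *m X) z ->
    cmod (z - b) <= cmod b /\ cmod a < cmod (z + a).
Proof.
move=> om chi1 hA [sol ext] hD z ez.
have chi0 : chi != 0 by rewrite -cmod_gt0 chi1.
pose lambda := chi^-1 * z.
have zE : z = chi * lambda by rewrite mulVKf.
have el : eigenvalue (D - K *m X) lambda.
  have /eigenvalueP[v vE v0] := ez; apply/eigenvalueP; exists v => //.
  rewrite /lambda -scalerA -vE -scalemxAl -scalerBr -scalemxAr scalerA.
  by rewrite mulVf // scale1r.
have [|i hi] := riccati_eigenvalue_disk sol el.
  move=> i; apply: (lt_le_trans (hA i)).
  have := omega_re_le omega (A i i + lambda); rewrite omega_reD.
  have := ext _ el; have := cmod_z_perp_le1 om; have := cmod_ge0 (A i i + lambda).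
  by nra.
have {}hi : cmod (z - chi * D i i) <= block_radius (chi *: D) (chi *: K) i.
  by rewrite block_radiusZ chi1 mul1r zE -mulrBr cmodM chi1 mul1r.
have [h1 h2] := hD i; rewrite mxE in h1 h2.
split.
  have -> : z - b = (z - chi * D i i) + (chi * D i i - b) by rewrite addrA subrK.
  by apply: le_trans (cmodD _ _) _; lra.
have := cmodD_ge (chi * D i i + a) (z - chi * D i i).
have -> : chi * D i i + a + (z - chi * D i i) = z + a by ring.
by lra.
Qed.

Lemma shift_dominant_of_bounds n m (D : 'M[C]_n) (K : 'M[C]_(n, m)) omega (chi : C)
    (s t : R) : 0 <= omega <= 1 -> cmod chi = 1 -> 0 < s ->
  (forall i, 0 < omega_re omega (chi * D i i) - block_radius D K i) ->
  (forall i, (varpi omega * cmod (D i i) ^+ 2 - block_radius D K i ^+ 2) /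
    (2 * varpi omega * (omega_re omega (chi * D i i) - block_radius D K i)) <= t) ->
  shift_dominant (chi *: D) (chi *: K) (s%:C * z_perp omega) (t%:C * z_perp omega).
Proof.
move=> om chi1 s0 h1 h2 i; rewrite block_radiusZ chi1 mul1r mxE.
have [|_ -> /(_ _ s0) ->] := cayley_shift_bounds om (block_radius_ge0 D K i) (h1 i) (t := t);
  last by [].
by rewrite cmodM chi1 mul1r.
Qed.

Lemma shift_bound_gt0 n m (D : 'M[C]_n) (K : 'M[C]_(n, m)) omega (chi : C) (t : R) :
  0 <= omega <= 1 -> cmod chi = 1 -> 'I_n ->
  (forall i, 0 < omega_re omega (chi * D i i) - block_radius D K i) ->
  (forall i, (varpi omega * cmod (D i i) ^+ 2 - block_radius D K i ^+ 2) /
    (2 * varpi omega * (omega_re omega (chi * D i i) - block_radius D K i)) <= t) ->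
  0 < t.
Proof.
move=> om chi1 i h1 h2.
have [|//] := cayley_shift_bounds om (block_radius_ge0 D K i) (h1 i) (t := t).
by rewrite cmodM chi1 mul1r.
Qed.

Lemma are_solutionZ m n (A : 'M[C]_m) (B : 'M[C]_(m, n)) (K : 'M[C]_(n, m))
    (D : 'M[C]_n) (X : 'M[C]_(m, n)) (a : C) :
  are_solution A B K D X ->
  are_solution (a *: A) (a *: B) (a *: K) (a *: D) X.
Proof.
rewrite /are_solution => sol.
by rewrite -!scalemxAr -!scalemxAl -!scalerBr -scalerDr sol scaler0.
Qed.

Lemma comparison_mx_ones omega k (M : 'M[C]_k) i :
  (comparison_mx omega M *m ones R k) i 0 = omega_re omega (M i i) - offdiag_sum M i.
Proof.
rewrite mxE (bigD1 i) //= !mxE eqxx mulr1 /offdiag_sum -sumrN; congr (_ + _).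
by apply: eq_bigr => j ji; rewrite !mxE eq_sym (negPf ji) mulr1.
Qed.

End Convergence.

Theorem theorem6p7 (R : realType) (omega : R) (m n : nat)
  (A : 'M[R[i]]_m) (B : 'M[R[i]]_(m, n))
  (C : 'M[R[i]]_(n, m)) (D : 'M[R[i]]_n)
  (Phi : 'M[R[i]]_(m, n)) (Psi : 'M[R[i]]_(n, m))
  (chi : R[i]) (t gamma : R) :
  let Q := are_mx A B C D in
  let psi1 : \bar R :=
    \big[maxe/-oo%E]_(i < m) (p_over_varpi omega chi Q (rshift n i))%:E in
  let psi2 : \bar R :=
    \big[maxe/-oo%E]_(i < n) (p_over_varpi omega chi Q (lshift m i))%:E in
  let alpha := t%:C * z_perp omega in
  let beta := gamma%:C * z_perp omega in
  let S := adda (chi *: A) (chi *: B) (chi *: C) (chi *: D) alpha beta in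
  (0 < m)%N -> (0 < n)%N ->
  0 <= omega <= 1 ->
  class_H omega A B C D ->
  pos_cvec (comparison_mx omega Q *m ones R (n + m)) ->
  extremal_solution omega A B C D Phi ->
  extremal_solution omega D C B A Psi ->
  `|chi| = 1 ->
  (forall i, 0 < omega_re omega (chi * Q i i) - offdiag_sum Q i) ->
  (psi1 <= t%:E)%E ->
  (psi2 <= gamma%:E)%E ->
  [/\ adda_well_defined (chi *: A) (chi *: B) (chi *: C) (chi *: D) alpha beta,
      quadratic_cvg (fun k => adda_H (S k)) Phi &
      quadratic_cvg (fun k => adda_G (S k)) Psi].
Proof.
move=> Q psi1 psi2 alpha beta S m0 n0 om _ Qpos exPhi exPsi chi_norm Qchi ht hgamma.
have chi1 : cmod chi = 1 by apply: (@complexI R); rewrite -cmodE chi_norm.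
have QD i : Q (lshift m i) (lshift m i) = D i i by rewrite /Q /are_mx block_mxEul.
have QA i : Q (rshift n i) (rshift n i) = A i i by rewrite /Q /are_mx block_mxEdr.
have rD i : offdiag_sum Q (lshift m i) = block_radius D C i := offdiag_sum_lshift _ _ _ _ i.
have rA i : offdiag_sum Q (rshift n i) = block_radius A B i := offdiag_sum_rshift _ _ _ _ i.
have domD i : block_radius D C i < omega_re omega (D i i).
  by have := Qpos (lshift m i); rewrite comparison_mx_ones QD rD subr_gt0.
have domA i : block_radius A B i < omega_re omega (A i i).
  by have := Qpos (rshift n i); rewrite comparison_mx_ones QA rA subr_gt0.
have chiD i : 0 < omega_re omega (chi * D i i) - block_radius D C i.
  by have := Qchi (lshift m i); rewrite QD rD.
have chiA i : 0 < omega_re omega (chi * A i i) - block_radius A B i.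
  by have := Qchi (rshift n i); rewrite QA rA.
have tA i : (varpi omega * cmod (A i i) ^+ 2 - block_radius A B i ^+ 2) /
    (2 * varpi omega * (omega_re omega (chi * A i i) - block_radius A B i)) <= t.
  rewrite -lee_fin; apply: le_trans ht.
  rewrite -(QA i) -(rA i).
  exact: (le_bigmax _ (fun i => (p_over_varpi omega chi Q (rshift n i))%:E) i).
have gD i : (varpi omega * cmod (D i i) ^+ 2 - block_radius D C i ^+ 2) /
    (2 * varpi omega * (omega_re omega (chi * D i i) - block_radius D C i)) <= gamma.
  rewrite -lee_fin; apply: le_trans hgamma.
  rewrite -(QD i) -(rD i).
  exact: (le_bigmax _ (fun i => (p_over_varpi omega chi Q (lshift m i))%:E) i).
have t0 : 0 < t := shift_bound_gt0 om chi1 (Ordinal m0) chiA tA.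
have gamma0 : 0 < gamma := shift_bound_gt0 om chi1 (Ordinal n0) chiD gD.
have zp0 : z_perp omega != 0 by rewrite -cmod_gt0 cmod_z_perp_gt0.
have real0 (r : R) : 0 < r -> r%:C != 0.
  by move=> r0; rewrite -cmod_gt0 cmod_real normr_gt0 gt_eqF.
have alpha0 : alpha != 0 by rewrite mulf_neq0 ?real0.
have beta0 : beta != 0 by rewrite mulf_neq0 ?real0.
have ab0 : alpha + beta != 0.
  by rewrite -mulrDl mulf_neq0 // -rmorphD real0 ?addr_gt0.
have hD := shift_dominant_of_bounds om chi1 t0 chiD gD.
have hA := shift_dominant_of_bounds om chi1 gamma0 chiA tA.
have [cvgH cvgG] := adda_quadratic_cvg alpha0 beta0 hD hA ab0
  (are_solutionZ chi exPhi.1) (are_solutionZ chi exPsi.1)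
  (extremal_eigenvalue_bounds om chi1 domA exPhi hD)
  (extremal_eigenvalue_bounds om chi1 domD exPsi hA).
by split; first exact: adda_well_defined_dominant.
Qed.
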